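(* Let $A$ be a selfadjoint operator (i.e., $F(x,Ay)=F(Ax,y)$) on a finite-dimensional vector space with nondegenerate $\varepsilon$-Hermitian form $F$ over a field $K$ of characteristic not $2$ ($\varepsilon=\pm1$; $\varepsilon=1$ for nonidentity involution on $K$). Then there exists a basis in which the pair $(A,F)$ is given by a direct sum of matrix pairs of the following types: (i) $\left(\Phi\oplus\Phi^*,\ \begin{bmatrix}0&\varepsilon I_n\\ I_n&0\end{bmatrix}\right)$, where $\Phi$ is an $n\times n$ Frobenius block and, if $\varepsilon=1$, then $\Phi_1$ does not exist; (ii) $A_\Phi^{f(x)}=(\Phi,\ \Phi_1f(\Phi))$, where $\varepsilon=1$, $0\ne f(x)=\bar f(x)\in K[x]$, and $\deg f<\deg p_\Phi$. The summands are determined as follows: type (i) up to replacement of $\Phi$ by $\Psi$ with $\chi_\Psi(x)=\bar\chi_\Phi(x)$; type (ii) up to replacement of the whole group $A_\Phi^{f_1(x)}\oplus\dots\oplus A_\Phi^{f_s(x)}$ with the same $\Phi$ by $A_\Phi^{g_1(x)}\oplus\dots\oplus A_\Phi^{g_s(x)}$ such that the Hermitian forms $f_1(\omega)x_1^\circ x_1+\dots+f_s(\omega)x_s^\circ x_s$ and $g_1(\omega)x_1^\circ x_1+\dots+g_s(\omega)x_s^\circ x_s$ are equivalent over the field $K[\omega]=K[x]/p_\Phi K[x]$ with involution $f(\omega)^\circ=\bar f(\omega)$.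
   Context: $K$ has an involution $a\mapsto\bar a$ (possibly the identity); $A^*=[\bar a_{ji}]$ for $A=[a_{ij}]$. A pair $(A,F)$ is given by the matrix of the operator and the Gram matrix of the form; direct sums of pairs are componentwise. A Frobenius block is a companion matrix with ones on the subdiagonal and last column $(-c_n,\dots,-c_1)^T$; its characteristic polynomial $\chi_\Phi=x^n+c_1x^{n-1}+\dots+c_n$ is a power of an irreducible polynomial $p_\Phi(x)$. For $f(x)=a_0x^n+\dots+a_n$, $\bar f(x)=\bar a_0x^n+\dots+\bar a_n$. $\Phi_1$ denotes a fixed nonsingular matrix with $\Phi_1=\Phi_1^*$ and $\Phi_1\Phi=(\Phi_1\Phi)^*$ (when it exists). *)

(* Defs.v *)
From HB Require Import structures.
From mathcomp Require Import all_boot all_order all_algebra.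
Set Implicit Arguments. Unset Strict Implicit. Unset Printing Implicit Defensive.
Import GRing.Theory.
Local Open Scope ring_scope.

Section Defs.
Variables (K : fieldType) (conj : {rmorphism K -> K}).

Definition ct m n (A : 'M[K]_(m, n)) : 'M[K]_(n, m) := map_mx conj A^T.

Definition conj_poly (f : {poly K}) : {poly K} := map_poly conj f.

Definition frob (c : {poly K}) : 'M[K]_((size c).-1) :=
  let d := (size c).-1 in
  \matrix_(i < d, j < d) if (j == d.-1 :> nat) then - c`_i else ((i == j.+1 :> nat)%:R).

Definition peval_mx n (M : 'M[K]_n) (f : {poly K}) : 'M[K]_n :=
  \sum_(i < size f) f`_i *: (iter i (mulmx M) 1%:M).

Definition is_Phi1 n (Phi H : 'M[K]_n) : Prop :=
  H \in unitmx /\ ct H = H /\ ct (H *m Phi) = H *m Phi.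

(* the data (p, k) of a Frobenius block with characteristic polynomial p^k,
   p monic irreducible, k >= 1 *)
Definition frob_data (p : {poly K}) (k : nat) : Prop :=
  p \is monic /\ irreducible_poly p /\ (0 < k)%N.

Definition Phi1_exists (c : {poly K}) : Prop :=
  exists H : 'M[K]_((size c).-1), is_Phi1 (frob c) H.

(* summands: S1 p k   = type (i) with Phi = frob (p^k);
             S2 p k f = type (ii) A_Phi^{f(x)} with Phi = frob (p^k) *)
Inductive summand :=
  | S1 of {poly K} & nat
  | S2 of {poly K} & nat & {poly K}.

Definition fsz (p : {poly K}) (k : nat) : nat := (size (p ^+ k)).-1.

Definition ssize (s : summand) : nat :=
  match s with
  | S1 p k => (fsz p k + fsz p k)%N
  | S2 p k _ => fsz p k
  end.

Variables (eps : K) (Phi1 : forall c : {poly K}, 'M[K]_((size c).-1)).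

Definition sA (s : summand) : 'M[K]_(ssize s) :=
  match s return 'M[K]_(ssize s) with
  | S1 p k => block_mx (frob (p ^+ k)) 0 0 (ct (frob (p ^+ k)))
  | S2 p k f => frob (p ^+ k)
  end.

Definition sF (s : summand) : 'M[K]_(ssize s) :=
  match s return 'M[K]_(ssize s) with
  | S1 p k => block_mx 0 (eps%:M) 1%:M 0
  | S2 p k f => Phi1 (p ^+ k) *m peval_mx (frob (p ^+ k)) f
  end.

Fixpoint tot (L : seq summand) : nat :=
  match L with [::] => 0%N | s :: L' => (ssize s + tot L')%N end.

Fixpoint dsA (L : seq summand) : 'M[K]_(tot L) :=
  match L return 'M[K]_(tot L) with
  | [::] => 0
  | s :: L' => block_mx (sA s) 0 0 (dsA L')
  end.

Fixpoint dsF (L : seq summand) : 'M[K]_(tot L) :=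
  match L return 'M[K]_(tot L) with
  | [::] => 0
  | s :: L' => block_mx (sF s) 0 0 (dsF L')
  end.

Definition canon_summand (s : summand) : Prop :=
  match s with
  | S1 p k => frob_data p k /\ (eps = 1 -> ~ Phi1_exists (p ^+ k))
  | S2 p k f => frob_data p k /\ eps = 1 /\ Phi1_exists (p ^+ k) /\
                f != 0 /\ conj_poly f = f /\ (size f < size p)%N
  end.

Fixpoint canon (L : seq summand) : Prop :=
  match L with [::] => True | s :: L' => canon_summand s /\ canon L' end.

Definition pair_equiv m n (A1 F1 : 'M[K]_m) (A2 F2 : 'M[K]_n) : Prop :=
  exists (P : 'M[K]_(m, n)) (Q : 'M[K]_(n, m)),
    Q *m P = 1%:M /\ P *m Q = 1%:M /\ A2 = Q *m A1 *m P /\ F2 = ct P *m F1 *m P.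

Fixpoint ones (L : seq summand) : seq {poly K} :=
  match L with
  | [::] => [::]
  | S1 p k :: L' => p ^+ k :: ones L'
  | S2 _ _ _ :: L' => ones L'
  end.

Fixpoint twos (c : {poly K}) (L : seq summand) : seq {poly K} :=
  match L with
  | [::] => [::]
  | S1 _ _ :: L' => twos c L'
  | S2 p k f :: L' => if p ^+ k == c then f :: twos c L' else twos c L'
  end.

(* Elements of K[omega] = K[x]/pK[x] are represented by polynomials modulo p;
   the involution is g(omega)^o = \bar g(omega).  The Hermitian forms
   f_1(w) x_1^o x_1 + ... + f_s(w) x_s^o x_s and g_1(w) x_1^o x_1 + ... are
   equivalent over K[omega] iff  S^o^T diag(f) S = diag(g)  for some
   nonsingular S over K[omega]. *)
Definition herm_equiv (p : {poly K}) (fs gs : seq {poly K}) : Prop :=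
  size fs = size gs /\
  exists S : 'M[{poly K}]_(size fs),
    ~~ (p %| \det S) /\
    forall i j : 'I_(size fs),
      p %| ((map_mx conj_poly S^T *m
             \matrix_(a < size fs, b < size fs) ((a == b)%:R * fs`_a) *m S) i j
            - (i == j)%:R * gs`_i).

(* the relation "obtained from each other by the allowed replacements"
   (and reordering of summands) *)
Definition canon_rel (L1 L2 : seq summand) : Prop :=
  (forall c : {poly K},
     count (fun d => (d == c) || (d == conj_poly c)) (ones L1) =
     count (fun d => (d == c) || (d == conj_poly c)) (ones L2)) /\
  (forall p k, frob_data p k -> herm_equiv p (twos (p ^+ k) L1) (twos (p ^+ k) L2)).

End Defs.

(* Main.v *)
Require Import Defs.
From HB Require Import structures.
From mathcomp Require Import all_boot all_order all_algebra zify ring.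
From Stdlib Require Import Classical.
Set Implicit Arguments. Unset Strict Implicit. Unset Printing Implicit Defensive.
Import GRing.Theory.
Local Open Scope ring_scope.

(* A is selfadjoint, so F(x, f(A) y) = F(fbar(A) x, y) for every polynomial f.

   Existence: let p^k be an exact power of an irreducible factor of the minimal
   polynomial of A; nondegeneracy of F gives a vector v killed by p^k and a
   vector w killed by pbar^k with F(w, p^(k-1) v) <> 0, and then the Gram matrix
   of the cyclic spaces of w and v is nonsingular.  If p = pbar and eps = 1,
   polarization allows w = v; the Gram matrix is then Phi_1 f(Phi) and a summand
   of type (ii) splits off, f being reduced modulo p by Hensel lifting.
   Otherwise both cyclic spaces are totally isotropic and a summand of type (i)
   splits off.

   Uniqueness: the second differences of j |-> rank p^j(A) count the blocks of
   each size.  The form F(y, p^(k-1) z) on the p^k-torsion only sees the blocks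
   of degree exactly k, where it is the Hermitian form with coefficients f_i
   modulo p.  Conversely, an equivalence of these forms modulo p lifts by
   Hensel's lemma (char <> 2) to one modulo p^k, whose entries evaluated at A
   give an isometry commuting with the operators. *)

(** The condition on [Phi1] is arithmetic in disguise: for [frob (p ^+ k)] such a matrix exists
    exactly when pbar = p. If it exists, it carries Phi to its conjugate transpose, so Phi is killed
    by the conjugate of its characteristic polynomial. Conversely, if pbar = p, the type (i) block
    for eps = 1 contains a vector whose cyclic Gram matrix serves as [Phi1]. Hence for a given p
    only one of the two types can occur, and a count that mixes them still separates them. The fixed
    [Phi1] need not be the Gram matrix met while splitting. Both intertwine Phi with its conjugate
    transpose, so their quotient commutes with Phi and is a polynomial in Phi; this is the origin of
    f. The field K[omega] and the rings K[x]/p^k are never formed; polynomials are compared by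
    divisibility. The functional h -> F(gen, h(Phi) gen) leads from matrices to congruences: it
    vanishes on no nonzero ideal of K[x]/p^k. These ideals form a chain, so p^(k-1) lies in every
    nonzero one, which is why nondegeneracy is tested on p^(k-1). *)

Section ConjugateTranspose.
Variables (K : fieldType) (conj : {rmorphism K -> K}).
Local Notation ct := (ct conj).

Lemma ctM m n p (A : 'M[K]_(m, n)) (B : 'M_(n, p)) :
  ct (A *m B) = ct B *m ct A.
Proof. by rewrite /ct trmx_mul map_mxM. Qed.

Lemma ctD m n (A B : 'M[K]_(m, n)) : ct (A + B) = ct A + ct B.
Proof. by rewrite /ct linearD map_mxD. Qed.

Lemma ctZ m n a (A : 'M[K]_(m, n)) : ct (a *: A) = conj a *: ct A.
Proof. by rewrite /ct linearZ map_mxZ. Qed.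

Lemma ct0 m n : ct (0 : 'M[K]_(m, n)) = 0.
Proof. by rewrite /ct linear0 map_mx0. Qed.

Lemma ct_scalar n a : ct (a%:M : 'M[K]_n) = (conj a)%:M.
Proof. by rewrite /ct tr_scalar_mx map_scalar_mx. Qed.

Lemma ct1 n : ct (1%:M : 'M[K]_n) = 1%:M.
Proof. by rewrite ct_scalar rmorph1. Qed.

Lemma ct_row m n p (A : 'M[K]_(m, n)) (B : 'M_(m, p)) :
  ct (row_mx A B) = col_mx (ct A) (ct B).
Proof. by rewrite /ct tr_row_mx map_col_mx. Qed.

Lemma ct_col m n p (A : 'M[K]_(m, n)) (B : 'M_(p, n)) :
  ct (col_mx A B) = row_mx (ct A) (ct B).
Proof. by rewrite /ct tr_col_mx map_row_mx. Qed.

Lemma ct_block m n p q (A : 'M[K]_(m, n)) B C (D : 'M_(p, q)) :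
  ct (block_mx A B C D) = block_mx (ct A) (ct C) (ct B) (ct D).
Proof. by rewrite /ct tr_block_mx map_block_mx. Qed.

Hypothesis conj_invol : involutive conj.

Lemma ctK m n (A : 'M[K]_(m, n)) : ct (ct A) = A.
Proof. by apply/matrixP => i j; rewrite !mxE conj_invol. Qed.

Lemma ct_inj m n : injective (fun A : 'M[K]_(m, n) => ct A).
Proof. by move=> A B e; rewrite -[A]ctK e ctK. Qed.

End ConjugateTranspose.

(** * Conjugation of polynomials *)

Section ConjugatePolynomial.
Variables (K : fieldType) (conj : {rmorphism K -> K}).
Local Notation cp := (conj_poly conj).

HB.instance Definition _ := GRing.RMorphism.copy cp (map_poly conj).

Lemma coef_cp f i : (cp f)`_i = conj f`_i.
Proof. exact: coef_map. Qed.

Lemma size_cp f : size (cp f) = size f.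
Proof. exact: size_map_poly. Qed.

Lemma cp_monic f : (cp f \is monic) = (f \is monic).
Proof. exact: map_monic. Qed.

Lemma dvdp_cp f g : (cp f %| cp g) = (f %| g).
Proof. exact: dvdp_map. Qed.

Hypothesis conj_invol : involutive conj.

Lemma cpK : involutive cp.
Proof. by move=> f; apply/polyP => i; rewrite !coef_cp conj_invol. Qed.

Lemma cp_irreducible f : irreducible_poly f -> irreducible_poly (cp f).
Proof.
case=> sf irr; split=> [|q sq dq]; first by rewrite size_cp.
rewrite -[q]cpK /eqp !dvdp_cp; apply: irr; first by rewrite size_cp.
by rewrite -dvdp_cp cpK.
Qed.

Lemma cp_frob_data p k : frob_data p k -> frob_data (cp p) k.
Proof. by case=> mp [ip kp]; split; rewrite ?cp_monic; [|split; [apply: cp_irreducible|]]. Qed.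

End ConjugatePolynomial.

(** * Powers of irreducible polynomials *)

Section PolynomialArithmetic.
Variable K : fieldType.
Implicit Types p q f g h c : {poly K}.

Lemma irreducible_coprime p f :
  irreducible_poly p -> ~~ (p %| f) -> coprimep p f.
Proof. by move=> ip; rewrite irreducible_poly_coprime. Qed.

Lemma irreducible_dvdp_mul p f g :
  irreducible_poly p -> (p %| f * g) = (p %| f) || (p %| g).
Proof.
move=> ip; case: (boolP (p %| f)) => [d | /(irreducible_coprime ip) cpf] /=.
  exact: dvdp_mulr.
by rewrite Gauss_dvdpr.
Qed.

Lemma irreducible_dvdp_exp p f k :
  irreducible_poly p -> p %| f ^+ k -> p %| f.
Proof.
move=> ip; elim: k => [|k IH]; last by rewrite exprS irreducible_dvdp_mul // => /orP[].
by rewrite expr0 dvdp1 => /eqP s; case: ip; rewrite s.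
Qed.

Lemma monic_irreducible_dvdp p q : p \is monic -> q \is monic ->
  irreducible_poly p -> irreducible_poly q -> p %| q -> p = q.
Proof.
move=> mp mq [sp _] [sq irr] d; apply/eqP; rewrite -eqp_monic //; apply: irr => //.
by rewrite neq_ltn sp orbT.
Qed.

Lemma frob_data_monic p k : frob_data p k -> p ^+ k \is monic.
Proof. by case=> mp _; apply: monic_exp. Qed.

Lemma size_monic_exp p k : p \is monic -> size (p ^+ k) = ((size p).-1 * k).+1.
Proof. by move=> mp; rewrite -(prednK (n := size (p ^+ k))) ?size_exp // size_poly_gt0 monic_neq0 ?monic_exp. Qed.

Lemma frob_data_deg p k : frob_data p k -> (0 < (size p).-1)%N.
Proof. by case=> _ [[sp _] _]; rewrite -subn1 subn_gt0. Qed.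

Lemma frob_data_inj p q k l : frob_data p k -> frob_data q l ->
  p ^+ k = q ^+ l -> p = q /\ k = l.
Proof.
move=> dp dq e; case: (dp) (dq) => mp [ip kp] [mq [iq lp]].
have epq : p = q.
  apply: monic_irreducible_dvdp => //; apply: (@irreducible_dvdp_exp _ _ l) => //.
  by rewrite -e; apply: dvdp_exp.
split=> //; move: (congr1 (fun f => size f) e); rewrite -epq !size_monic_exp // => -[] /eqP.
by rewrite eqn_pmul2l ?(frob_data_deg dp) // => /eqP.
Qed.

Lemma frob_data_coprime p q k l : frob_data p k -> frob_data q l -> p != q ->
  coprimep (p ^+ k) (q ^+ l).
Proof.
case=> mp [ip _] [mq [iq _]] npq; apply/coprimep_expl/coprimep_expr.
apply: irreducible_coprime => //; apply: contra npq => d.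
by apply/eqP/monic_irreducible_dvdp.
Qed.

(** The least nonzero ideal of K[x]/p^k is generated by p^(k-1), so it is contained in the ideal
    generated by any nonzero [h]. *)
Lemma irreducible_exp_bezout p k h : irreducible_poly p -> (0 < k)%N ->
  ~~ (p ^+ k %| h) -> exists a b, a * h + b * p ^+ k = p ^+ k.-1.
Proof.
move=> ip; elim: k h => // k IH h _ ndvd.
case: (boolP (p %| h)) => [/dvdpP [h1 eh] | np].
  case: k IH ndvd => [_|k IH ndvd]; first by rewrite eh expr1 dvdp_mull.
  have /IH : ~~ (p ^+ k.+1 %| h1).
    apply: contra ndvd; rewrite eh => d.
    by rewrite exprSr dvdp_mul2r // irredp_neq0.
  case=> // a [b e]; exists a, b; rewrite eh /= [p ^+ k.+2]exprSr !mulrA -mulrDl e /=.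
  by rewrite -exprSr.
have /Bezout_eq1_coprimepP [[u v] /= e] : coprimep h (p ^+ k.+1).
  by apply: coprimep_expr; rewrite coprimep_sym irreducible_coprime.
by exists (p ^+ k * u), (p ^+ k * v); rewrite -!mulrA -mulrDr e mulr1.
Qed.

Lemma irreducible_factor f : (1 < size f)%N ->
  exists2 p, p \is monic /\ irreducible_poly p & p %| f.
Proof.
elim/ltn_ind: (size f) {-2}f (erefl (size f)) => n IH g sg n1.
have [[q [d sq sqg]] | no] := classic (exists q, [/\ q %| g, (1 < size q)%N & (size q < n)%N]).
  have [p mp pq] : exists2 p, p \is monic /\ irreducible_poly p & p %| q.
    exact: (IH _ sqg q erefl sq).
  by exists p => //; apply: dvdp_trans d.
have g0 : g != 0 by rewrite -size_poly_gt0 ltnW.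
exists ((lead_coef g)^-1 *: g); last by rewrite dvdpZl // invr_eq0 lead_coef_eq0.
split; first by rewrite monicE lead_coefZ mulVf // lead_coef_eq0.
have lc : (lead_coef g)^-1 != 0 by rewrite invr_eq0 lead_coef_eq0.
split=> [|q sq]; first by rewrite size_scale.
rewrite dvdpZr // => d; rewrite (eqp_trans (y := g)) //; last by rewrite eqp_sym eqp_scale.
rewrite -dvdp_size_eqp // eqn_leq dvdp_leq //= leqNgt; apply/negP => lt; case: no.
exists q; split=> //; last by rewrite -sg.
by rewrite ltn_neqAle eq_sym sq size_poly_gt0 (dvdpN0 d).
Qed.

End PolynomialArithmetic.

(** * Polynomials evaluated at a square matrix *)

Section PolynomialsInMatrices.
Variable K : fieldType.
Implicit Types f g c : {poly K}.
Local Notation pm := peval_mx.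

(** Square matrices form a nonzero ring in positive dimension only, while an empty direct sum has
    dimension 0. There the rules below hold because all matrices are equal. *)
Lemma peval_mx_horner n (M : 'M[K]_n.+1) f : pm M f = horner_mx M f.
Proof.
rewrite /peval_mx -[in RHS](coefK f) poly_def rmorph_sum; apply: eq_bigr => i _.
rewrite /= linearZ /= rmorphXn /= horner_mx_X; congr (_ *: _).
by elim: (nat_of_ord i) => [|j IH] //=; rewrite IH exprS.
Qed.

Lemma pm0 n (M : 'M[K]_n) : pm M 0 = 0.
Proof. by rewrite /peval_mx size_poly0 big_ord0. Qed.

Lemma pmD n (M : 'M[K]_n) f g : pm M (f + g) = pm M f + pm M g.
Proof. case: n M => [|n] M; [by rewrite [LHS]flatmx0 [RHS]flatmx0 | by rewrite !peval_mx_horner rmorphD]. Qed.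

Lemma pmN n (M : 'M[K]_n) f : pm M (- f) = - pm M f.
Proof. case: n M => [|n] M; [by rewrite [LHS]flatmx0 [RHS]flatmx0 | by rewrite !peval_mx_horner rmorphN]. Qed.

Lemma pmB n (M : 'M[K]_n) f g : pm M (f - g) = pm M f - pm M g.
Proof. by rewrite pmD pmN. Qed.

Lemma pmM n (M : 'M[K]_n) f g : pm M (f * g) = pm M f *m pm M g.
Proof. case: n M => [|n] M; [by rewrite [LHS]flatmx0 [RHS]flatmx0 | by rewrite !peval_mx_horner rmorphM]. Qed.

Lemma pmC n (M : 'M[K]_n) a : pm M a%:P = a%:M.
Proof. case: n M => [|n] M; [by rewrite [LHS]flatmx0 [RHS]flatmx0 | by rewrite !peval_mx_horner horner_mx_C]. Qed.

Lemma pm1 n (M : 'M[K]_n) : pm M 1 = 1%:M.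
Proof. by rewrite -polyC1 pmC. Qed.

Lemma pmX n (M : 'M[K]_n) : pm M 'X = M.
Proof. case: n M => [|n] M; [by rewrite [LHS]flatmx0 [RHS]flatmx0 | by rewrite !peval_mx_horner horner_mx_X]. Qed.

Lemma pmZ n (M : 'M[K]_n) a f : pm M (a *: f) = a *: pm M f.
Proof. by rewrite -mul_polyC pmM pmC mul_scalar_mx. Qed.

Lemma pm_comm n (M : 'M[K]_n) f g : pm M f *m pm M g = pm M g *m pm M f.
Proof. by rewrite -!pmM mulrC. Qed.

Lemma pm_sum n (M : 'M[K]_n) I (r : seq I) (P : pred I) (E : I -> {poly K}) :
  pm M (\sum_(i <- r | P i) E i) = \sum_(i <- r | P i) pm M (E i).
Proof. exact: (big_morph _ (pmD M) (pm0 M)). Qed.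

Lemma pm_intertwine m n (A : 'M[K]_m) (B : 'M_n) X f :
  A *m X = X *m B -> pm A f *m X = X *m pm B f.
Proof.
move=> e; rewrite /peval_mx mulmx_suml mulmx_sumr; apply: eq_bigr => i _.
rewrite -scalemxAl -scalemxAr; congr (_ *: _).
elim: (nat_of_ord i) => [|j IH] /=; first by rewrite mul1mx mulmx1.
by rewrite -mulmxA IH !mulmxA e.
Qed.

Lemma pm_block m n (A : 'M[K]_m) (B : 'M_n) f :
  pm (block_mx A 0 0 B) f = block_mx (pm A f) 0 0 (pm B f).
Proof.
have eA : block_mx A 0 0 B *m col_mx 1%:M 0 = col_mx 1%:M 0 *m A.
  by rewrite mul_block_col mul_col_mx !(mulmx1, mul1mx) !mul0mx !mulmx0 !addr0.
have eB : block_mx A 0 0 B *m col_mx 0 1%:M = col_mx 0 1%:M *m B.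
  by rewrite mul_block_col mul_col_mx !(mulmx1, mul1mx) !mul0mx !mulmx0 !add0r.
rewrite -[LHS]mulmx1 scalar_mx_block [X in _ *m X]block_mxEh mul_mx_row.
rewrite (pm_intertwine f eA) (pm_intertwine f eB) !mul_col_mx !mul1mx !mul0mx.
by rewrite block_mxEh.
Qed.

Lemma pm_ct (conj : {rmorphism K -> K}) n (A : 'M[K]_n) f :
  ct conj (pm A f) = pm (ct conj A) (conj_poly conj f).
Proof.
elim/poly_ind: f => [|f a IH]; first by rewrite rmorph0 !pm0 ct0.
rewrite rmorphD rmorphM /= !pmD !pmM ctD ctM IH /conj_poly map_polyX map_polyC /=.
by rewrite !pmX !pmC ct_scalar -[X in X *m pm _ _](pmX (ct conj A)) pm_comm pmX.
Qed.

End PolynomialsInMatrices.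

(** * Cyclic spaces and Krylov matrices *)

Section Krylov.
Variable K : fieldType.
Implicit Types f g c : {poly K}.
Local Notation pm := peval_mx.

Definition krylov n (A : 'M[K]_n) (v : 'cV_n) d : 'M_(n, d) :=
  \matrix_(i < n, j < d) (pm A 'X^j *m v) i 0.

Lemma krylov_mulv n (A : 'M[K]_n) v d (u : 'cV_d) :
  krylov A v d *m u = pm A (rVpoly u^T) *m v.
Proof.
have -> : rVpoly u^T = \sum_(j < d) u j 0 *: 'X^j.
  rewrite {1}[u^T]row_sum_delta linear_sum; apply: eq_bigr => j _ /=.
  by rewrite linearZ /= rVpoly_delta mxE.
apply/matrixP => i j; rewrite ord1 pm_sum mulmx_suml summxE mxE.
by apply: eq_bigr => k _; rewrite pmZ -scalemxAl [RHS]mxE mulrC [krylov _ _ _ _ _]mxE.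
Qed.

Lemma krylov_poly n (A : 'M[K]_n) v d f : (size f <= d)%N ->
  pm A f *m v = krylov A v d *m (poly_rV f)^T.
Proof. by move=> sf; rewrite krylov_mulv trmxK poly_rV_K. Qed.

Lemma krylov_intertwine m n (A : 'M[K]_m) (B : 'M_n) X v d :
  A *m X = X *m B -> krylov A (X *m v) d = X *m krylov B v d.
Proof.
move=> e; apply/matrixP => i j; rewrite [LHS]mxE mulmxA (pm_intertwine _ e) -mulmxA mxE [RHS]mxE.
by apply: eq_bigr => k _; rewrite [krylov _ _ _ _ _]mxE.
Qed.

Lemma krylov_eq0 n m (A : 'M[K]_n) v d (M : 'M_(m, n)) :
  (forall f, M *m pm A f *m v = 0) -> M *m krylov A v d = 0.
Proof.
move=> e; apply/matrixP => i j; rewrite [RHS]mxE.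
transitivity ((M *m pm A 'X^j *m v) i 0); last by rewrite e mxE.
rewrite -mulmxA [LHS]mxE [RHS]mxE.
by apply: eq_bigr => k _; rewrite [krylov _ _ _ _ _]mxE.
Qed.

Lemma eq_krylov n m (A : 'M[K]_n) v d (M N : 'M_(m, n)) :
  (forall f, M *m pm A f *m v = N *m pm A f *m v) ->
  M *m krylov A v d = N *m krylov A v d.
Proof.
move=> e; apply/eqP; rewrite -subr_eq0 -mulmxBl; apply/eqP/krylov_eq0 => f.
by rewrite !mulmxBl e subrr.
Qed.

(* [frob c] with its dimension freed from [c], so that [c] and its conjugate give matrices of the same type. *)
Definition frobd d c : 'M[K]_d :=
  \matrix_(i, j) (if (j == d.-1 :> nat) then - c`_i else (i == j.+1 :> nat)%:R).

Lemma krylov_frobd n (A : 'M[K]_n) v d c : c \is monic -> d = (size c).-1 ->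
  pm A c *m v = 0 -> A *m krylov A v d = krylov A v d *m frobd d c.
Proof.
move=> mc dc cv; apply/trmx_inj/row_matrixP => j; apply/trmx_inj; rewrite !tr_row !trmxK.
rewrite !colE -!mulmxA -!colE krylov_mulv.
have sc : size c = d.+1 by rewrite dc prednK // size_poly_gt0 monic_neq0.
have -> : A *m col j (krylov A v d) = pm A 'X^(j.+1) *m v.
  rewrite exprS pmM pmX -mulmxA; congr (_ *m _).
    by apply/matrixP => i k; rewrite mxE [LHS]mxE ord1.
case: (eqVneq (j : nat) d.-1) => [ej | nj]; last first.
  have lt : (j.+1 < d)%N by have := ltn_ord j; lia.
  have -> : (col j (frobd d c))^T = delta_mx 0 (Ordinal lt).
    by apply/matrixP => a b; rewrite !mxE (negPf nj) ord1 eqxx.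
  by rewrite rVpoly_delta.
have d0 : (0 < d)%N by apply: leq_ltn_trans (ltn_ord j).
rewrite ej prednK //; apply/eqP; rewrite -subr_eq0 -mulmxBl -pmB.
(* The last column of the companion matrix lists the coefficients of ['X^d - c], so the two sides
   differ by c(A) v, which vanishes. *)
suff -> : 'X^d - rVpoly (col j (frobd d c))^T = c by rewrite cv.
apply/polyP => i; rewrite coefB coefXn.
have lc : c`_d = 1 by move/monicP: mc; rewrite /lead_coef sc.
case: (ltngtP i d) => [lt | gt | ->].
- have := coef_rVpoly_ord (col j (frobd d c))^T (Ordinal lt) => /= ->.
  by rewrite !mxE ej eqxx sub0r opprK.
- by rewrite !nth_default ?subr0 ?sc // (leq_trans (size_poly _ _)) // ltnW.
- by rewrite [(rVpoly _)`_d]nth_default ?subr0 ?lc // size_poly.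
Qed.

Lemma krylov_frob n (A : 'M[K]_n) v c : c \is monic ->
  pm A c *m v = 0 ->
  A *m krylov A v (size c).-1 = krylov A v (size c).-1 *m frob c.
Proof. by move=> mc; apply: krylov_frobd. Qed.

End Krylov.

(** * The companion matrix as a cyclic operator *)

Section FrobeniusBlock.
Variables (K : fieldType) (c : {poly K}).
Implicit Types f g : {poly K}.
Local Notation pm := peval_mx.
Local Notation d := (size c).-1.

(** The standard cyclic vector. Indices are compared in [nat] because the dimension [(size c).-1] is
    not a successor by its form. *)
Definition gen : 'cV[K]_d := \col_i (i == 0 :> nat)%:R.

Lemma pm_frob_Xn_gen j : (j < d)%N -> pm (frob c) 'X^j *m gen = \col_i (i == j :> nat)%:R.
Proof.
elim: j => [|j IH] lt; first by rewrite pm1 mul1mx.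
have nj : j != (size c).-1.-1 by lia.
rewrite exprS pmM pmX -mulmxA IH ?(ltnW lt) //.
apply/matrixP => i k; rewrite !mxE (bigD1 (Ordinal (ltnW lt))) //= !mxE eqxx mulr1.
rewrite big1 ?addr0 => [|l nl]; last first.
  by rewrite !mxE; move: nl; rewrite -val_eqE /= => /negPf ->; rewrite mulr0.
by rewrite ifN.
Qed.

Lemma krylov_gen : krylov (frob c) gen d = 1%:M.
Proof.
by apply/matrixP => i j; rewrite mxE pm_frob_Xn_gen // !mxE.
Qed.

Lemma pm_frob_gen f : (size f <= d)%N -> pm (frob c) f *m gen = (poly_rV f)^T.
Proof. by move=> sf; rewrite (krylov_poly _ _ sf) krylov_gen mul1mx. Qed.

Lemma frob_cyclic m (M N : 'M_(m, d)) :
  (forall f, M *m pm (frob c) f *m gen = N *m pm (frob c) f *m gen) -> M = N.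
Proof. by move=> e; have := eq_krylov d e; rewrite krylov_gen !mulmx1. Qed.

Hypothesis monic_c : c \is monic.

Let sizec : size c = d.+1. Proof. by rewrite prednK // size_poly_gt0 monic_neq0. Qed.

(** Cayley-Hamilton through the cyclic vector: c(Phi) commutes with all polynomials in Phi, so it
    vanishes once it kills [gen]. *)
Lemma pm_frob : pm (frob c) c = 0.
Proof.
case: (posnP d) => [d0|d0]; first by apply/matrixP => i; move: (ltn_ord i); rewrite [X in (_ < X)%N]d0.
suff e0 : pm (frob c) c *m gen = 0.
  by apply: frob_cyclic => f; rewrite pm_comm -mulmxA e0 mulmx0 !mul0mx.
(* As ['X^d - c] has degree below d, it sends [gen] to its own coefficient vector. This is the last
   column of [frob c], which is also Phi^d gen. *)
rewrite (_ : pm _ c = pm (frob c) ('X^d - ('X^d - c))); last by rewrite subKr.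
have le : (size ('X^d - c)%R <= d)%N.
  apply/leq_sizeP => i; rewrite leq_eqVlt => /orP[/eqP <- | lt].
    by rewrite coefB coefXn; move/monicP: monic_c; rewrite /lead_coef => ->; rewrite eqxx subrr.
  rewrite coefB coefXn [c`_i]nth_default ?subr0; last by rewrite sizec; lia.
  by case: eqP => //; lia.
rewrite pmB mulmxBl (pm_frob_gen le) (_ : 'X^d = 'X * 'X^(d.-1)); last by rewrite -exprS prednK.
rewrite pmM pmX -mulmxA pm_frob_Xn_gen; last by rewrite ltn_predL.
apply/eqP; rewrite subr_eq0; apply/eqP/matrixP => i k; rewrite !mxE.
have lt : (d.-1 < d)%N by rewrite ltn_predL.
rewrite (bigD1 (Ordinal lt)) //= !mxE eqxx mulr1 big1 => [|l nl].
  by rewrite addr0 -exprS prednK // coefB coefXn ltn_eqF ?sub0r.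
by rewrite !mxE; move: nl; rewrite -val_eqE /= => /negPf ->; rewrite mulr0.
Qed.

Lemma pm_frob_gen_eq0 f : (pm (frob c) f *m gen == 0) = (c %| f).
Proof.
apply/eqP/idP => [e | /dvdpP [g ->]]; last by rewrite pmM pm_frob mulmx0 mul0mx.
rewrite /dvdp; have sr : (size (f %% c)%R <= d)%N.
  by rewrite -ltnS -sizec ltn_modp monic_neq0.
have : pm (frob c) (f %% c) *m gen = 0.
  by move: e; rewrite {1}(divp_eq f c) pmD pmM pm_frob mulmx0 add0r.
rewrite (pm_frob_gen sr) => /(congr1 (fun M => rVpoly M^T)).
by rewrite /= trmxK poly_rV_K // trmx0 linear0 => ->.
Qed.

Lemma pm_frob_eq0 f : (pm (frob c) f == 0) = (c %| f).
Proof.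
apply/idP/idP => [/eqP e | /dvdpP [g ->]]; last by rewrite pmM pm_frob mulmx0.
by rewrite -pm_frob_gen_eq0 e mul0mx.
Qed.

Lemma frob_gen_span (v : 'cV_d) : exists2 f : {poly K}, (size f <= d)%N & v = pm (frob c) f *m gen.
Proof.
by exists (rVpoly v^T); rewrite ?size_poly // -krylov_mulv krylov_gen mul1mx.
Qed.

(** [M] is determined by its value on the cyclic vector. That value is f(Phi) gen for some f, and
    f(Phi) commutes with Phi as [M] does. *)
Lemma frob_commutant (M : 'M_d) : M *m frob c = frob c *m M ->
  exists2 f : {poly K}, (size f <= d)%N & M = pm (frob c) f.
Proof.
move=> comM; have [f sf ef] := frob_gen_span (M *m gen).
exists f => //; apply: frob_cyclic => g.
by rewrite -(pm_intertwine g (esym comM)) -mulmxA ef !mulmxA pm_comm.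
Qed.

Lemma pm_frob_unit f : coprimep f c -> pm (frob c) f \in unitmx.
Proof.
case/Bezout_eq1_coprimepP => [[u v]] /= e.
have : pm (frob c) u *m pm (frob c) f = 1%:M.
  by move: (congr1 (pm (frob c)) e); rewrite pmD !pmM pm_frob mulmx0 addr0 pm1.
by move/mulmx1_unit => [].
Qed.

End FrobeniusBlock.

(** * Equivalence of pairs and its compatibility with direct sums *)

Section PairEquivalence.
Variables (K : fieldType) (conj : {rmorphism K -> K}).
Local Notation ct := (ct conj).

Lemma pair_equiv_refl n (A F : 'M[K]_n) : pair_equiv conj A F A F.
Proof. by exists 1%:M, 1%:M; rewrite ct1 !mul1mx !mulmx1. Qed.

Lemma pair_equiv_sym m n (A1 F1 : 'M[K]_m) (A2 F2 : 'M[K]_n) :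
  pair_equiv conj A1 F1 A2 F2 -> pair_equiv conj A2 F2 A1 F1.
Proof.
case=> P [Q [QP [PQ [-> ->]]]]; exists Q, P; split=> //; split=> //; split.
  by rewrite !mulmxA PQ mul1mx -mulmxA PQ mulmx1.
by rewrite !mulmxA -ctM PQ ct1 mul1mx -mulmxA PQ mulmx1.
Qed.

Lemma pair_equiv_trans l m n (A1 F1 : 'M[K]_l) (A2 F2 : 'M[K]_m) (A3 F3 : 'M[K]_n) :
  pair_equiv conj A1 F1 A2 F2 -> pair_equiv conj A2 F2 A3 F3 ->
  pair_equiv conj A1 F1 A3 F3.
Proof.
case=> P [Q [QP [PQ [-> ->]]]] [P' [Q' [QP' [PQ' [-> ->]]]]].
exists (P *m P'), (Q' *m Q); rewrite ctM !mulmxA; split.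
  by rewrite -[Q' *m Q *m P]mulmxA QP mulmx1.
by rewrite -[P *m P' *m Q']mulmxA PQ' mulmx1.
Qed.

Lemma pair_equiv_dim m n (A1 F1 : 'M[K]_m) (A2 F2 : 'M[K]_n) :
  pair_equiv conj A1 F1 A2 F2 -> m = n.
Proof.
case=> P [Q [QP [PQ _]]]; apply/eqP; rewrite eqn_leq.
rewrite -{1}(mxrank1 K m) -{2}(mxrank1 K n) -{1}PQ -QP.
by rewrite (leq_trans (mxrankM_maxl _ _) (rank_leq_col _)) (leq_trans (mxrankM_maxl _ _) (rank_leq_col _)).
Qed.

(** Since [F2] is invertible, the isometry P has an explicit left inverse, which is two-sided by
    equality of dimensions. That equality is a hypothesis because the sizes in the applications are
    equal only propositionally. *)
Lemma embed_pair_equiv m n (A1 F1 : 'M[K]_m) (A2 F2 : 'M[K]_n) (P : 'M_(m, n)) :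
  m = n -> F2 \in unitmx -> A1 *m P = P *m A2 -> ct P *m F1 *m P = F2 ->
  pair_equiv conj A1 F1 A2 F2.
Proof.
move=> emn; case: n / emn A2 F2 P => A2 F2 P uF eA eF.
have QP : invmx F2 *m (ct P *m F1) *m P = 1%:M by rewrite -mulmxA eF mulVmx.
exists P, (invmx F2 *m (ct P *m F1)); rewrite QP (mulmx1C QP) eF.
by do 2?split=> //; rewrite -mulmxA eA mulmxA QP mul1mx.
Qed.

Lemma pair_equiv_block m n m' n' (A1 F1 : 'M[K]_m) (A2 F2 : 'M[K]_n)
    (B1 G1 : 'M[K]_m') (B2 G2 : 'M[K]_n') :
  pair_equiv conj A1 F1 A2 F2 -> pair_equiv conj B1 G1 B2 G2 ->
  pair_equiv conj (block_mx A1 0 0 B1) (block_mx F1 0 0 G1)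
                  (block_mx A2 0 0 B2) (block_mx F2 0 0 G2).
Proof.
case=> P [Q [QP [PQ [-> ->]]]] [P' [Q' [QP' [PQ' [-> ->]]]]].
exists (block_mx P 0 0 P'), (block_mx Q 0 0 Q').
rewrite ct_block !ct0 !mulmx_block !(mul0mx, mulmx0, addr0, add0r).
by rewrite QP QP' PQ PQ' -!scalar_mx_block.
Qed.

Lemma pair_equiv_cast m n (e : m = n) (A F : 'M[K]_m) :
  pair_equiv conj A F (castmx (e, e) A) (castmx (e, e) F).
Proof. by case: n / e; rewrite !castmx_id; apply: pair_equiv_refl. Qed.

Lemma pair_equiv_blockA l m n (A1 F1 : 'M[K]_l) (A2 F2 : 'M[K]_m) (A3 F3 : 'M[K]_n) :
  pair_equiv conj (block_mx (block_mx A1 0 0 A2) 0 0 A3) (block_mx (block_mx F1 0 0 F2) 0 0 F3)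
    (block_mx A1 0 0 (block_mx A2 0 0 A3)) (block_mx F1 0 0 (block_mx F2 0 0 F3)).
Proof.
have E (X : 'M[K]_l) (Y : 'M[K]_m) (Z : 'M[K]_n) : block_mx X 0 0 (block_mx Y 0 0 Z) =
    castmx (esym (addnA l m n), esym (addnA l m n)) (block_mx (block_mx X 0 0 Y) 0 0 Z).
  by have := @block_mxA K l m n l m n X 0 0 0 Y 0 0 0 Z; rewrite /= !row_mx0 !col_mx0.
by rewrite !E; apply: pair_equiv_cast.
Qed.

Lemma pair_equiv_blockC m n (A1 F1 : 'M[K]_m) (A2 F2 : 'M[K]_n) :
  pair_equiv conj (block_mx A1 0 0 A2) (block_mx F1 0 0 F2)
                  (block_mx A2 0 0 A1) (block_mx F2 0 0 F1).
Proof.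
exists (block_mx 0 1%:M 1%:M 0), (block_mx 0 1%:M 1%:M 0).
rewrite ct_block !ct0 !ct1 !mulmx_block.
by rewrite !(mul0mx, mulmx0, mul1mx, mulmx1, addr0, add0r) -!scalar_mx_block.
Qed.

Lemma pair_equiv_block0 n (A F : 'M[K]_n) :
  pair_equiv conj A F (block_mx A 0 0 (0 : 'M_0)) (block_mx F 0 0 (0 : 'M_0)).
Proof.
exists (row_mx 1%:M 0), (col_mx 1%:M 0).
have e (M : 'M[K]_n) : col_mx 1%:M 0 *m M *m row_mx 1%:M 0 = block_mx M 0 0 (0 : 'M_0).
  by rewrite mul_col_mx mul_col_row !(mul0mx, mul1mx, mulmx0, mulmx1).
rewrite ct_row ct0 ct1 !e mul_row_col mulmx1 mulmx0 addr0; split=> //.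
by rewrite mul_col_row scalar_mx_block !(mul0mx, mulmx0, mulmx1); congr block_mx; rewrite [RHS]flatmx0.
Qed.

End PairEquivalence.

(** * Gram matrices of cyclic spaces *)

Section SelfadjointPairs.
Variables (K : fieldType) (conj : {rmorphism K -> K}).
Hypothesis conj_invol : involutive conj.
Local Notation ct := (ct conj).
Local Notation cp := (conj_poly conj).
Local Notation pm := peval_mx.
Implicit Types f g c : {poly K}.

Definition selfadj n (A F : 'M[K]_n) := F *m A = ct A *m F.

Lemma selfadj_pm n (A F : 'M[K]_n) f : selfadj A F -> F *m pm A f = ct (pm A (cp f)) *m F.
Proof. by move=> sa; rewrite pm_ct cpK // (pm_intertwine f (esym sa)). Qed.

Lemma selfadj_shift n a b (A F : 'M[K]_n) f (w : 'M_(n, a)) (v : 'M_(n, b)) : selfadj A F ->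
  ct (pm A f *m w) *m F *m v = ct w *m F *m (pm A (cp f) *m v).
Proof. by move=> sa; rewrite ctM !mulmxA -[ct w *m F *m _]mulmxA (selfadj_pm _ sa) cpK // !mulmxA. Qed.

(** Selfadjointness moves every power of A to one side, and conjugation fixes powers of X. So the
    Gram matrix is of Hankel form and depends only on the functional f -> F(w, f(A) v). *)
Lemma gram_entry n (A F : 'M[K]_n) (w v : 'cV_n) a b i j : selfadj A F ->
  (ct (krylov A w a) *m F *m krylov A v b) i j =
  (ct w *m F *m (pm A 'X^(i + j) *m v)) 0 0.
Proof.
move=> sa; transitivity ((ct (pm A 'X^i *m w) *m F *m (pm A 'X^j *m v)) 0 0).
  rewrite [LHS]mxE [RHS]mxE; apply: eq_bigr => k _; congr (_ * _); last by rewrite mxE.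
  by rewrite [LHS]mxE [RHS]mxE; apply: eq_bigr => l _; rewrite /ct !mxE.
rewrite selfadj_shift // /conj_poly map_polyXn [pm A 'X^i *m _]mulmxA -pmM -exprD.
by [].
Qed.

Lemma eq_gram n m (A F : 'M[K]_n) (A' F' : 'M[K]_m) (w v : 'cV_n) (w' v' : 'cV_m) a b :
  selfadj A F -> selfadj A' F' ->
  (forall f, ct w *m F *m (pm A f *m v) = ct w' *m F' *m (pm A' f *m v')) ->
  ct (krylov A w a) *m F *m krylov A v b = ct (krylov A' w' a) *m F' *m krylov A' v' b.
Proof. by move=> sa sa' e; apply/matrixP => i j; rewrite !gram_entry // e. Qed.

Lemma gram_eq0 n (A F : 'M[K]_n) (w v : 'cV_n) a b : selfadj A F ->
  (forall f, ct w *m F *m (pm A f *m v) = 0) ->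
  ct (krylov A w a) *m F *m krylov A v b = 0.
Proof. by move=> sa e; apply/matrixP => i j; rewrite gram_entry // e !mxE. Qed.

Lemma unitmx_ker0 n (B : 'M[K]_n) : (forall u : 'cV_n, B *m u = 0 -> u = 0) -> B \in unitmx.
Proof.
move=> inj; rewrite -unitmx_tr -row_free_unit -kermx_eq0; apply/eqP/row_matrixP => i.
rewrite row0; apply: trmx_inj; rewrite trmx0; apply: inj.
apply: trmx_inj; rewrite trmx_mul trmxK trmx0; apply/sub_kermxP; exact: row_sub.
Qed.

(** A kernel vector is a polynomial h such that h(A) v is orthogonal to the cyclic space of w. If h
    were nonzero modulo p^k, its ideal would contain p^(k-1), against the last hypothesis. *)
Lemma gram_unit n (A F : 'M[K]_n) (w v : 'cV_n) p k : selfadj A F -> frob_data p k ->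
  pm A (cp (p ^+ k)) *m w = 0 -> pm A (p ^+ k) *m v = 0 ->
  ct w *m F *m (pm A (p ^+ k.-1) *m v) != 0 ->
  ct (krylov A w (fsz p k)) *m F *m krylov A v (fsz p k) \in unitmx.
Proof.
move=> sa dp cw cv nz; have mc := frob_data_monic dp; case: (dp) => mp [ip k0].
apply: unitmx_ker0 => u; rewrite -mulmxA krylov_mulv; set h := rVpoly _ => Bu.
have all0 g : ct w *m F *m (pm A g *m (pm A h *m v)) = 0.
  (* [Bu] tests only polynomials of degree below the number of Krylov columns; reduction modulo p^k
     brings g into this range. *)
  have -> : pm A g *m (pm A h *m v) = pm A (g %% p ^+ k) *m (pm A h *m v).
    rewrite {1}(divp_eq g (p ^+ k)) pmD mulmxDl pmM -[RHS]add0r; congr (_ + _).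
    by rewrite -!mulmxA [pm A (p ^+ k) *m _]mulmxA pm_comm -mulmxA cv !mulmx0.
  rewrite -[g %% _](cpK conj_invol) -selfadj_shift // (krylov_poly _ _ (d := fsz p k)); last first.
    rewrite size_cp -ltnS prednK ?ltn_modp ?size_poly_gt0 ?monic_neq0 //.
  by rewrite ctM -!mulmxA mulmxA in Bu *; rewrite Bu mulmx0.
have [d|nd] := boolP (p ^+ k %| h); last first.
  have [a [b e]] := irreducible_exp_bezout ip k0 nd.
  case/eqP: nz; rewrite -e pmD mulmxDl mulmxDr !pmM -!mulmxA cv !mulmx0 addr0.
  by rewrite mulmxA.
apply: trmx_inj; rewrite trmx0 -[u^T]rVpolyK -/h.
suff -> : h = 0 by rewrite linear0.
rewrite -(modp_small (p := h) (q := p ^+ k)) ?(eqP d) //.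
by rewrite -[X in (_ < X)%N]prednK ?ltnS ?size_poly // size_poly_gt0 monic_neq0.
Qed.

End SelfadjointPairs.

(** * Splitting off a nondegenerate summand *)

Section Splitting.
Variables (K : fieldType) (conj : {rmorphism K -> K}).
Hypothesis conj_invol : involutive conj.
Variables (eps : K) (Phi1 : forall c : {poly K}, 'M[K]_((size c).-1)).
Local Notation ct := (ct conj).
Local Notation cp := (conj_poly conj).
Local Notation pm := peval_mx.
Implicit Types f g c : {poly K}.

(** The image of X is nondegenerate and invariant, so its orthogonal complement is a complementary
    subspace, invariant because A is selfadjoint. *)
Lemma split_pair n d (A F : 'M[K]_n) (B G : 'M_d) (X : 'M_(n, d)) :
  F \in unitmx -> ct F = eps *: F -> selfadj conj A F ->
  A *m X = X *m B -> ct X *m F *m X = G -> G \in unitmx ->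
  exists r (A' F' : 'M_r), [/\ F' \in unitmx, ct F' = eps *: F', selfadj conj A' F' &
    pair_equiv conj A F (block_mx B 0 0 A') (block_mx G 0 0 F')].
Proof.
move=> uF hF sa eA eG uG.
have [J eJ] : exists J, J = invmx G *m (ct X *m F) by exists (invmx G *m (ct X *m F)).
have JX : J *m X = 1%:M by rewrite eJ -mulmxA eG mulVmx.
(* R is the projection onto the orthogonal complement. Its rank factorization Y Z yields a basis Y
   of the complement and the coordinates Z in it. *)
set R := 1%:M - X *m J; set Y := col_base R; set Z := row_base R.
have YZ : Y *m Z = R by apply: mulmx_base.
have /row_fullP [Y' YY'] : row_full Y by apply: col_base_full.
have /row_freeP [Z' ZZ'] : row_free Z by apply: row_base_free.
move: (\rank R) Y Z YZ Y' YY' Z' ZZ' => r Y Z YZ Y' YY' Z' ZZ'.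
have RX : R *m X = 0 by rewrite mulmxBl -mulmxA JX mulmx1 mul1mx subrr.
have JR : J *m R = 0 by rewrite mulmxBr mulmxA JX mulmx1 mul1mx subrr.
have RR : R *m R = R by rewrite {1}/R mulmxBl -mulmxA JR mulmx0 mul1mx subr0.
have ZX : Z *m X = 0 by rewrite -[Z]mul1mx -YY' -!mulmxA [Y *m _]mulmxA YZ RX mulmx0.
have JY : J *m Y = 0 by rewrite -[J *m Y]mulmx1 -ZZ' mulmxA -[J *m Y *m Z]mulmxA YZ JR mul0mx.
(* R is idempotent, so Y Z Y Z = Y Z; one cancels Y on the left and Z on the right. *)
have ZY : Z *m Y = 1%:M.
  rewrite -[LHS]mul1mx -YY' -[LHS]mulmx1 -ZZ' !mulmxA -[Y' *m Y *m Z]mulmxA YZ.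
  by rewrite -[_ *m Y *m Z]mulmxA YZ -[Y' *m R *m R]mulmxA RR -YZ !mulmxA YY' mul1mx ZZ'.
have XFY : ct X *m F *m Y = 0.
  by rewrite -[ct X *m F](mulKVmx uG) -eJ -mulmxA JY mulmx0.
have YFX : ct Y *m F *m X = 0.
  apply: (ct_inj conj_invol); rewrite !ctM ctK // hF ct0.
  by rewrite -scalemxAl -scalemxAr mulmxA XFY scaler0.
set P := row_mx X Y; set Q := col_mx J Z.
have QP : Q *m P = 1%:M.
  by rewrite mul_col_row JX JY ZX ZY -scalar_mx_block.
have PQ : P *m Q = 1%:M by rewrite mul_row_col YZ /R addrC subrK.
have eQAP : Q *m A *m P = block_mx B 0 0 (Z *m A *m Y).
  rewrite mul_col_mx mul_col_row -!mulmxA eA !mulmxA JX ZX mul1mx mul0mx.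
  congr (block_mx _ _ _ _); rewrite eJ -!mulmxA [F *m _]mulmxA sa -!mulmxA.
  by rewrite [ct X *m _]mulmxA -ctM eA ctM -!mulmxA [ct X *m _]mulmxA XFY !mulmx0.
have ePFP : ct P *m F *m P = block_mx G 0 0 (ct Y *m F *m Y).
  by rewrite ct_row mul_col_mx mul_col_row eG XFY YFX.
exists r, (Z *m A *m Y), (ct Y *m F *m Y); split; last first.
- by exists P, Q; rewrite QP PQ eQAP ePFP.
- have : selfadj conj (Q *m A *m P) (ct P *m F *m P).
    rewrite /selfadj !ctM -!mulmxA [P *m _]mulmxA PQ mul1mx.
    by rewrite [ct Q *m _]mulmxA -ctM PQ ct1 mul1mx !mulmxA -[ct P *m F *m A]mulmxA sa !mulmxA.
  rewrite eQAP ePFP /selfadj ct_block !mulmx_block !ct0 !(mul0mx, mulmx0, addr0, add0r).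
  by case/eq_block_mx.
- by rewrite !ctM ctK // hF -scalemxAl -scalemxAr mulmxA.
- have : ct P *m F *m P \in unitmx.
    have /mulmx1_unit [] // : ct P *m F *m P *m (Q *m invmx F *m ct Q) = 1%:M.
    by rewrite -!mulmxA [P *m _]mulmxA PQ mul1mx [F *m _]mulmxA mulmxV // mul1mx -ctM QP ct1.
  by rewrite ePFP !unitmxE det_ublock unitrM => /andP[].
Qed.

Lemma polarize n (N : 'M[K]_n) (w v : 'cV_n) : (2%:R : K) != 0 ->
  ct N = N -> ct w *m N *m v != 0 ->
  exists a b, let z := a *: w + b *: v in ct z *m N *m z != 0.
Proof.
move=> two hN nz; apply: NNPP => no.
have z0 a b : ct (a *: w + b *: v) *m N *m (a *: w + b *: v) = 0.
  by apply/eqP/negPn/negP => nz'; case: no; exists a, b.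
have ww : ct w *m N *m w = 0 by have := z0 1 0; rewrite !scale1r scale0r addr0.
have vv : ct v *m N *m v = 0 by have := z0 0 1; rewrite !scale1r scale0r add0r.
have [t et] : exists t, ct w *m N *m v = t%:M.
  by exists ((ct w *m N *m v) 0 0); apply: mx11_scalar.
have t0 : t != 0 by move: nz; rewrite et; apply: contraNneq => ->; rewrite raddf0.
have vw : ct v *m N *m w = (conj t)%:M by rewrite -ct_scalar -et !ctM hN ctK // mulmxA.
(* This coefficient makes both cross terms equal to 1, so the value is 2; unscaled, they would be t
   and its conjugate, whose sum may vanish. *)
have := z0 (conj t^-1) 1; rewrite scale1r ctD ctZ conj_invol !mulmxDl !mulmxDr.
rewrite -!scalemxAl -!scalemxAr ww vv et vw scaler0 scaler0 add0r addr0.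
rewrite -!mul_scalar_mx -!scalar_mxM mulVf // -rmorphM mulVf // rmorph1.
rewrite -raddfD => /matrixP /(_ 0 0); rewrite !mxE => /eqP.
by rewrite rmorph1 /= mulr1n -mulr2n (negPf two).
Qed.

(** The two cyclic spaces are isotropic and in duality through the invertible Gram matrix B.
    Replacing W by the basis Y dual to V makes the form hyperbolic, and the selfadjoint A acts on a
    dual basis by the conjugate transpose. *)
Lemma S1_embed n (A F : 'M[K]_n) (w v : 'cV_n) p k :
  ct F = eps *: F -> conj eps = eps -> selfadj conj A F -> frob_data p k ->
  pm A (cp (p ^+ k)) *m w = 0 -> pm A (p ^+ k) *m v = 0 ->
  ct w *m F *m (pm A (p ^+ k.-1) *m v) != 0 ->
  (forall f, ct w *m F *m (pm A f *m w) = 0) ->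
  (forall f, ct v *m F *m (pm A f *m v) = 0) ->
  exists X : 'M_(n, ssize (S1 p k)), A *m X = X *m sA conj (S1 p k) /\
    ct X *m F *m X = sF eps Phi1 (S1 p k).
Proof.
move=> hF epsc sa dp cw cv nz ww vv; have mc := frob_data_monic dp.
have uB := gram_unit conj_invol sa dp cw cv nz.
set W := krylov A w (fsz p k) in uB; set V := krylov A v (fsz p k) in uB.
move eB: (ct W *m F *m V) uB => B uB.
have [Y eYW] : exists Y, Y = W *m ct (invmx B) by exists (W *m ct (invmx B)).
have eV : A *m V = V *m frob (p ^+ k) by apply: krylov_frob.
have eW : A *m W = W *m frobd (fsz p k) (cp (p ^+ k)).
  by apply: krylov_frobd; rewrite ?cp_monic // size_cp.
have BPhi : B *m frob (p ^+ k) = ct (frobd (fsz p k) (cp (p ^+ k))) *m B.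
  by rewrite -eB -!mulmxA -eV [F *m _]mulmxA sa !mulmxA -!ctM eW ctM.
have eY : A *m Y = Y *m ct (frob (p ^+ k)).
  have e : frob (p ^+ k) *m invmx B = invmx B *m ct (frobd (fsz p k) (cp (p ^+ k))).
    by rewrite -[LHS](mulKmx uB) [B *m _]mulmxA BPhi -mulmxA mulmxV // mulmx1.
  rewrite eYW mulmxA eW -!mulmxA -ctM e ctM ctK //.
have YV : ct Y *m F *m V = 1%:M by rewrite eYW ctM ctK // -!mulmxA [ct W *m _]mulmxA eB mulVmx.
have VY : ct V *m F *m Y = eps%:M.
  apply: (ct_inj conj_invol); rewrite !ctM ctK // hF -scalemxAl -scalemxAr mulmxA YV.
  by rewrite ct_scalar epsc scalemx1.
exists (row_mx V Y); split.
  by rewrite /= mul_mx_row mul_row_block eV eY !mulmx0 addr0 add0r.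
rewrite /= ct_row mul_col_mx mul_col_row YV VY.
rewrite (gram_eq0 conj_invol) // [ct Y *m _ *m _](_ : _ = 0) //.
by rewrite eYW ctM -!mulmxA [F *m _]mulmxA [ct W *m _]mulmxA [ct W *m _]mulmxA (gram_eq0 conj_invol) // mul0mx mulmx0.
Qed.

End Splitting.

(** * Hensel lifting of Hermitian congruences *)

Section Hensel.
Variables (K : fieldType) (conj : {rmorphism K -> K}).
Hypothesis conj_invol : involutive conj.
Hypothesis two_neq0 : (2%:R : K) != 0.
Local Notation cp := (conj_poly conj).
Implicit Types f g c : {poly K}.

Definition star s t (M : 'M[{poly K}]_(s, t)) : 'M_(t, s) := map_mx cp M^T.

Lemma starM s t r (M : 'M_(s, t)) (N : 'M_(t, r)) : star (M *m N) = star N *m star M.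
Proof. by rewrite /star trmx_mul map_mxM. Qed.

Lemma starD s t (M N : 'M_(s, t)) : star (M + N) = star M + star N.
Proof. by rewrite /star linearD map_mxD. Qed.

Lemma starZ s t a (M : 'M_(s, t)) : star (a *: M) = cp a *: star M.
Proof. by rewrite /star linearZ map_mxZ. Qed.

Lemma star1 s : star (1%:M : 'M_s) = 1%:M.
Proof. by rewrite /star tr_scalar_mx map_scalar_mx /= rmorph1. Qed.

Lemma starK s t (M : 'M_(s, t)) : star (star M) = M.
Proof. by apply/matrixP => i j; rewrite !mxE cpK. Qed.

(* Newton step: if [T^* D T = D' + q E], replace [T] by [T (1 - q V E / 2)],
   where [V] inverts [D'] modulo [p]. *)
Lemma hensel s (D D' V U T E : 'M[{poly K}]_s) p k :
  p != 0 -> cp p = p -> star D = D -> star D' = D' -> star V = V ->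
  V *m D' = 1%:M + p *: U -> star T *m D *m T = D' + p *: E ->
  exists T' E', star T' *m D *m T' = D' + p ^+ k.+1 *: E'.
Proof.
move=> p0 cpp sD sD' sV eV eT; elim: k => [|k [{eT} {}T [{}E eT]]].
  by exists T, E; rewrite expr1.
have eV' : D' *m V = 1%:M + p *: star U.
  by rewrite -[LHS]starK starM sD' sV eV starD starZ star1 cpp.
have q0 : p ^+ k.+1 != 0 by rewrite expf_neq0.
(* The other terms of the congruence are selfadjoint, and the nonzero factor p^(k+1) cancels. *)
have sE : star E = E.
  have : star (star T *m D *m T) = star T *m D *m T by rewrite !starM starK sD mulmxA.
  rewrite eT starD sD' starZ rmorphXn /= cpp => /addrI /matrixP e.
  by apply/matrixP => i j; apply: (mulfI q0); have := e i j; rewrite !mxE.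
set h : {poly K} := (- 2%:R^-1)%:P.
have hh : h + h = -1.
  by rewrite -polyCD -mulr2n -[_ *+ 2]mulr_natr mulNr mulVf // polyCN.
have ch : cp h = h by rewrite /conj_poly map_polyC /= rmorphN fmorphV rmorph_nat.
set X := h *: (V *m E).
have sX : star X = h *: (E *m V) by rewrite starZ ch starM sE sV.
exists (T + p ^+ k.+1 *: (T *m X)),
  (h *: (E *m U + star U *m E) + p ^+ k *: (star X *m E + E *m X +
      star X *m (D' + p ^+ k.+1 *: E) *m X)).
transitivity ((D' + p ^+ k.+1 *: E) + p ^+ k.+1 *: (star X *m (D' + p ^+ k.+1 *: E)) +
   p ^+ k.+1 *: ((D' + p ^+ k.+1 *: E) *m X) +
   (p ^+ k.+1 * p ^+ k.+1) *: (star X *m (D' + p ^+ k.+1 *: E) *m X)).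
  rewrite -eT starD starZ rmorphXn /= cpp starM !mulmxDl !mulmxDr -!scalemxAl -!scalemxAr !mulmxA.
  by apply/matrixP => i j; rewrite ![(_ + _ : 'M_s) i j]mxE ![(_ *: _ : 'M_s) i j]mxE; ring.
have e1 : star X *m D' = h *: (E + p *: (E *m U)).
  by rewrite sX -scalemxAl -mulmxA eV mulmxDr mulmx1 -scalemxAr.
have e2 : D' *m X = h *: (E + p *: (star U *m E)).
  by rewrite -scalemxAr mulmxA eV' mulmxDl mul1mx -scalemxAl.
move: (star X *m (D' + p ^+ k.+1 *: E) *m X) => m1.
rewrite mulmxDr mulmxDl e1 e2 -scalemxAl -scalemxAr.
move: (star X *m E) (E *m X) (E *m U) (star U *m E) => m2 m3 m4 m5.
apply/matrixP => i j; rewrite !mxE !exprS; apply/eqP; rewrite -subr_eq0; apply/eqP.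
(* With q = p^(k+1), the coefficient of q E is 1 + h + h = 0. The other linear terms gain a factor p
   from U, and the quadratic ones from q^2. *)
transitivity (p * p ^+ k * E i j * (h + h + 1)); [ring | by rewrite hh addNr mulr0].
Qed.

Lemma inv_mod_selfadjoint p g : irreducible_poly p -> cp p = p -> cp g = g -> ~~ (p %| g) ->
  exists v u, cp v = v /\ v * g = 1 + p * u.
Proof.
move=> ip cpp cg ng; have /Bezout_eq1_coprimepP [[u v] /= e] : coprimep p g.
  exact: irreducible_coprime.
(* Both [v] and [cp v] invert g modulo p; their product with g is a selfadjoint inverse. *)
exists (v * cp v * g), (u * cp u * p - u - cp u).
have ce : cp u * p + cp v * g = 1 by rewrite -{1}cpp -{1}cg -!rmorphM -rmorphD e rmorph1.
split; first by rewrite !rmorphM /= cpK // cg [cp v * v]mulrC.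
have e1 : v * g = 1 - u * p by rewrite -e; ring.
have e2 : cp v * g = 1 - cp u * p by rewrite -ce; ring.
have -> : v * cp v * g * g = (v * g) * (cp v * g) by ring.
by rewrite e1 e2; ring.
Qed.

(** As p divides no entry of [gs], the diagonal matrix of [gs] has a selfadjoint inverse modulo p,
    as the Newton step requires. *)
Lemma herm_hensel p (fs gs : seq {poly K}) k : irreducible_poly p -> cp p = p ->
  {in fs, forall f, cp f = f} -> {in gs, forall g, cp g = g /\ ~~ (p %| g)} ->
  herm_equiv conj p fs gs ->
  exists T : nat -> nat -> {poly K}, forall i j, (i < size fs)%N -> (j < size fs)%N ->
    p ^+ k %| \sum_(a < size fs) fs`_a * cp (T a i) * T a j - (i == j)%:R * gs`_i.
Proof.
move=> ip cpp cfs cgs [sz [S [_ eS]]]; have p0 := irredp_neq0 ip.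
set s := size fs in sz S eS *.
pose D := \matrix_(a < s, b < s) ((a == b)%:R * fs`_a).
pose D' := \matrix_(a < s, b < s) ((a == b)%:R * gs`_a).
have sdiag (hs : seq {poly K}) : (forall a : 'I_s, cp hs`_a = hs`_a) ->
    star (\matrix_(a < s, b < s) ((a == b)%:R * hs`_a)) = \matrix_(a < s, b < s) ((a == b)%:R * hs`_a).
  move=> ch; apply/matrixP => i j; rewrite !mxE rmorphM rmorph_nat /= ch eq_sym.
  by case: eqP => [->|] //; rewrite !mul0r.
have cg (a : 'I_s) : cp gs`_a = gs`_a /\ ~~ (p %| gs`_a).
  by apply: cgs; rewrite mem_nth // -sz.
have [v] : exists v : 'I_s -> {poly K} * {poly K},
    forall a, cp (v a).1 = (v a).1 /\ (v a).1 * gs`_a = 1 + p * (v a).2.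
  apply: (@fin_all_exists 'I_s (fun _ => ({poly K} * {poly K})%type)
    (fun (a : 'I_s) w => cp w.1 = w.1 /\ w.1 * gs`_a = 1 + p * w.2)).
  move=> a; have [cga nga] := cg a; have [v [u [cv ev]]] := inv_mod_selfadjoint ip cpp cga nga.
  by exists (v, u).
move=> ev.
have [E eE] : exists E, star S *m D *m S = D' + p *: E.
  have {}eS i j : p %| (star S *m D *m S) i j - D' i j.
    by have := eS i j; rewrite [D' i j]mxE.
  move: (star S *m D *m S) eS => M eS; exists (\matrix_(i, j) ((M i j - D' i j) %/ p)).
  by apply/matrixP => i j; rewrite [RHS]mxE [X in _ + X]mxE [X in _ * X]mxE mulrC divpK ?subrKC.
have [T [E2 eT]] : exists T E, star T *m D *m T = D' + p ^+ k.+1 *: E.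
  apply: (@hensel s D D' (\matrix_(a, b) ((a == b)%:R * (v a).1)) (\matrix_(a, b) ((a == b)%:R * (v a).2)) S E) => //.
  - by apply: sdiag => a; apply: cfs; apply: mem_nth.
  - by apply: sdiag => a; case: (cg a).
  - apply/matrixP => i j; rewrite !mxE rmorphM rmorph_nat /= (ev j).1 eq_sym.
    by case: eqP => [->|] //; rewrite !mul0r.
  - apply/matrixP => i j; rewrite mxE (bigD1 i) //= big1 => [|l]; last first.
      by rewrite !mxE eq_sym => /negPf ->; rewrite !mul0r.
    rewrite !mxE eqxx mul1r addr0; case: (eqVneq i j) => _.
      by rewrite !mul1r (ev i).2.
    by rewrite !mul0r !mulr0 addr0.
(* T is extended by 0 outside the index range, so that it can be applied to indices of either
   list. *)
exists (fun a i => if (insub a, insub i) is (Some a', Some i') then T a' i' else 0) => i j lti ltj.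
rewrite -[i]/(val (Ordinal lti)) -[j]/(val (Ordinal ltj)).
move: (Ordinal lti) (Ordinal ltj) => {lti ltj} {}i {}j.
rewrite (eq_bigr (fun a : 'I_s => fs`_a * cp (T a i) * T a j)) => [|a _]; last by rewrite !valK.
have -> : \sum_(a < size fs) fs`_a * cp (T a i) * T a j = (star T *m D *m T) i j.
  rewrite -mulmxA [RHS]mxE; apply: eq_bigr => a _; rewrite [(D *m T) a j]mxE (bigD1 a) //= big1 => [|l].
    by rewrite !mxE eqxx mul1r addr0 [fs`_a * _]mulrC mulrA.
  by rewrite mxE eq_sym => /negPf ->; rewrite !mul0r.
by rewrite eT !mxE addrAC subrr add0r exprS -mulrA dvdp_mull // dvdp_mulr.
Qed.

End Hensel.

(** * Existence of Phi1 and the functional of a cyclic block *)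

Section Phi1.
Variables (K : fieldType) (conj : {rmorphism K -> K}).
Hypothesis conj_invol : involutive conj.
Local Notation ct := (ct conj).
Local Notation cp := (conj_poly conj).
Local Notation pm := peval_mx.
Implicit Types f g c h p q : {poly K}.

(** The invertible intertwiner H shows that the conjugate of p^k also kills Phi; hence p divides its
    conjugate, and both are monic irreducible. *)
Lemma Phi1_exists_cp p k : frob_data p k -> Phi1_exists conj (p ^+ k) -> cp p = p.
Proof.
move=> dp [H [uH [hH sH]]]; have mc := frob_data_monic dp; case: (dp) => mp [ip k0].
have [mp' [ip' _]] := cp_frob_data conj_invol dp.
apply/esym/monic_irreducible_dvdp => //; apply: (@irreducible_dvdp_exp _ _ _ k) => //.
rewrite -rmorphXn /=; apply: (dvdp_trans (dvdp_exp k0 (dvdpp p))).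
rewrite -pm_frob_eq0 //; apply/eqP; apply: (can_inj (mulKmx uH)).
have sa : selfadj conj (frob (p ^+ k)) H by rewrite /selfadj -sH ctM hH.
by rewrite mulmx0 (selfadj_pm conj_invol) // cpK // pm_frob // ct0 mul0mx.
Qed.

Section Nondegeneracy.
Variables (c : {poly K}) (H : 'M[K]_((size c).-1)).
Hypotheses (mc : c \is monic) (phiH : is_Phi1 conj (frob c) H).

(** The functional on K[x]/c through which the form factors: the value of the form at f(Phi) gen and
    g(Phi) gen is its value at [cp f * g]. *)
Definition cyclic_form h := ct (gen c) *m H *m (pm (frob c) h *m gen c).

Lemma is_Phi1_selfadj : selfadj conj (frob c) H.
Proof. by case: phiH => _ [hH sH]; rewrite /selfadj -sH ctM hH. Qed.

Lemma cyclic_form_shift f h g :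
  ct (pm (frob c) f *m gen c) *m H *m (pm (frob c) h *m (pm (frob c) g *m gen c)) =
  cyclic_form (cp f * h * g).
Proof.
by rewrite (selfadj_shift conj_invol _ _ _ is_Phi1_selfadj) /cyclic_form !pmM !mulmxA.
Qed.

(** If the functional vanishes on the ideal of h, then h(Phi) gen is orthogonal to the whole space,
    and H is invertible. *)
Lemma cyclic_form_nondeg h : (forall g, cyclic_form (h * g) = 0) -> c %| h.
Proof.
move=> h0; case: phiH => uH [hH sH]; rewrite -pm_frob_gen_eq0 //; apply/eqP.
apply: (can_inj (mulKmx uH)); rewrite mulmx0; apply: (ct_inj conj_invol); rewrite ct0.
apply: frob_cyclic => g; rewrite !mul0mx -mulmxA; apply: (ct_inj conj_invol).
rewrite ct0 ctM ctK // mulmxA -[_ *m gen c in X in _ *m X]mul1mx -(pm1 (frob c)) mulmxA.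
by rewrite -[X in X = 0]mulmxA cyclic_form_shift mulr1 mulrC h0.
Qed.

End Nondegeneracy.

(** Serves twice: it shows that [Phi1] exists, and it relates the Gram matrix of a cyclic summand to
    the fixed [Phi1]. *)
Lemma gram_is_Phi1 n (A F : 'M[K]_n) z p k : ct F = F -> selfadj conj A F ->
  frob_data p k -> cp p = p -> pm A (p ^+ k) *m z = 0 ->
  ct z *m F *m (pm A (p ^+ k.-1) *m z) != 0 ->
  is_Phi1 conj (frob (p ^+ k)) (ct (krylov A z (fsz p k)) *m F *m krylov A z (fsz p k)).
Proof.
move=> hF sa dp cpp cz nz; have mc := frob_data_monic dp.
have hG : ct (ct (krylov A z (fsz p k)) *m F *m krylov A z (fsz p k)) =
  ct (krylov A z (fsz p k)) *m F *m krylov A z (fsz p k).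
  by rewrite !ctM ctK // hF mulmxA.
split; first by apply: (gram_unit conj_invol) => //; rewrite rmorphXn /= cpp.
split=> //; rewrite ctM hG; have := krylov_frob mc cz.
rewrite -/(fsz p k); move: (krylov A z _) => Z eZ.
rewrite !mulmxA -ctM -eZ ctM -[ct Z *m ct A *m F]mulmxA -sa.
by rewrite -!mulmxA eZ.
Qed.

(** Because [cp p = p], the matrix of F(x, p^(k-1)(A) y) is Hermitian, so polarization applies to
    it. *)
Lemma ex_anisotropic n (A F : 'M[K]_n) (w v : 'cV_n) p k : (2%:R : K) != 0 ->
  ct F = F -> selfadj conj A F -> cp p = p ->
  pm A (p ^+ k) *m w = 0 -> pm A (p ^+ k) *m v = 0 ->
  ct w *m F *m (pm A (p ^+ k.-1) *m v) != 0 ->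
  exists2 z : 'cV_n, pm A (p ^+ k) *m z = 0 & ct z *m F *m (pm A (p ^+ k.-1) *m z) != 0.
Proof.
move=> two hF sa cpp cw cv; rewrite mulmxA -[_ *m _ *m pm _ _]mulmxA => nz.
have hN : ct (F *m pm A (p ^+ k.-1)) = F *m pm A (p ^+ k.-1).
  by rewrite (selfadj_pm conj_invol _ sa) ctM ctK // hF rmorphXn /= cpp (selfadj_pm conj_invol _ sa) rmorphXn /= cpp.
have [a [b z0]] := polarize conj_invol two hN nz.
exists (a *: w + b *: v); first by rewrite mulmxDr -!scalemxAr cw cv !scaler0 addr0.
by rewrite mulmxA -[_ *m _ *m pm _ _]mulmxA.
Qed.

End Phi1.

(** * Type (i) blocks *)

Section S1Block.
Variables (K : fieldType) (conj : {rmorphism K -> K}).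
Hypothesis conj_invol : involutive conj.
Variables (eps : K) (Phi1 : forall c : {poly K}, 'M[K]_((size c).-1)).
Hypotheses (eps2 : eps * eps = 1) (eps_conj : conj eps = eps).
Local Notation ct := (ct conj).
Local Notation cp := (conj_poly conj).
Local Notation pm := peval_mx.
Implicit Types f g c h p q : {poly K}.
Variables (p : {poly K}) (k : nat).
Hypothesis dp : frob_data p k.
Local Notation A := (sA conj (S1 p k)).
Local Notation F := (sF eps Phi1 (S1 p k)).

Lemma S1_unit : F \in unitmx.
Proof.
apply: (proj1 (@mulmx1_unit _ _ _ (ct F) _)); rewrite /= ct_block !ct0 ct1 ct_scalar eps_conj.
rewrite mulmx_block !(mul0mx, mulmx0, addr0, add0r, mulmx1) -scalar_mxM eps2.
by rewrite -scalar_mx_block.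
Qed.

Lemma S1_herm : ct F = eps *: F.
Proof.
rewrite /= ct_block !ct0 ct1 ct_scalar eps_conj scale_block_mx !scaler0.
by rewrite !scale_scalar_mx eps2 mulr1.
Qed.

Lemma S1_selfadj : selfadj conj A F.
Proof.
rewrite /selfadj /= ct_block !ct0 ctK // !mulmx_block.
by rewrite !(mul0mx, mulmx0, addr0, add0r, mulmx1, mul1mx) scalar_mxC.
Qed.

Lemma S1_ann : pm A (p ^+ k * cp (p ^+ k)) = 0.
Proof.
have mc := frob_data_monic dp.
rewrite pm_block !pmM -[pm (ct _) (cp _)]pm_ct pm_frob // ct0 !(mul0mx, mulmx0).
exact: block_mx_const.
Qed.

(** One vector from each isotropic half, in the roles that [S1_embed] expects for the conjugate
    polynomial. *)
Lemma S1_isotropic_pair : exists w v : 'cV_(fsz p k + fsz p k),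
  [/\ pm A (p ^+ k) *m w = 0, pm A (cp (p ^+ k)) *m v = 0,
      ct w *m F *m (pm A (cp p ^+ k.-1) *m v) != 0,
      forall f, ct w *m F *m (pm A f *m w) = 0 &
      forall f, ct v *m F *m (pm A f *m v) = 0].
Proof.
have mc := frob_data_monic dp; case: (dp) => mp [ip k0].
set Phi := frob (p ^+ k).
have x0 : pm Phi (p ^+ k.-1) *m gen _ != 0.
  rewrite pm_frob_gen_eq0 // gtNdvdp ?expf_neq0 ?irredp_neq0 //.
  by rewrite !size_monic_exp // ltnS ltn_pmul2l ?(frob_data_deg dp) // ltn_predL.
have [i nxi] : exists i, (pm Phi (p ^+ k.-1) *m gen _) i 0 != 0.
  apply: NNPP => no; case/eqP: x0; apply/matrixP => i j; rewrite ord1 [RHS]mxE.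
  by apply/eqP/negPn/negP => nz; apply: no; exists i.
have ctp f : pm (ct Phi) (cp f) = ct (pm Phi f) by rewrite pm_ct.
(* The second half is dual to the first, so the basis vector at a nonzero coordinate [i] of
   p^(k-1)(Phi) gen detects it. *)
exists (col_mx (gen _) 0), (col_mx 0 (delta_mx i 0)); rewrite /= -/Phi !pm_block; split.
- by rewrite mul_block_col pm_frob // !(mul0mx, mulmx0, addr0) col_mx0.
- by rewrite mul_block_col ctp pm_frob // ct0 !(mul0mx, mulmx0, addr0) col_mx0.
- rewrite ct_col ct0 mul_row_block mul_block_col mul_row_col !(mul0mx, mulmx0, addr0, add0r).
  rewrite -rmorphXn /= ctp mul_mx_scalar -scalemxAl mulmxA -ctM.
  move: (pm Phi _ *m gen _) nxi => x; apply: contraNneq; rewrite -colE => /matrixP /(_ 0 0).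
  rewrite !mxE => /eqP; rewrite mulf_eq0 fmorph_eq0 => /orP[/eqP e0|//].
  by move: eps2 (oner_neq0 K) => <-; rewrite e0 mul0r eqxx.
- by move=> f; rewrite pm_block ct_col ct0 mul_row_block mul_block_col mul_row_col !(mul0mx, mulmx0, addr0, add0r).
- by move=> f; rewrite pm_block ct_col ct0 mul_row_block mul_block_col mul_row_col !(mul0mx, mulmx0, addr0, add0r).
Qed.

End S1Block.

(** * Direct sums of canonical blocks *)

Section DirectSums.
Variables (K : fieldType) (conj : {rmorphism K -> K}).
Hypothesis conj_invol : involutive conj.
Variables (eps : K) (Phi1 : forall c : {poly K}, 'M[K]_((size c).-1)).
Hypotheses (eps2 : eps * eps = 1) (eps_conj : conj eps = eps).
Local Notation ct := (ct conj).
Local Notation cp := (conj_poly conj).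
Local Notation pm := peval_mx.
Local Notation sA := (sA conj).
Local Notation sF := (sF eps Phi1).
Local Notation dsA := (dsA conj).
Local Notation dsF := (dsF eps Phi1).
Implicit Types (f g c h p q : {poly K}) (s : summand K) (L M : seq (summand K)).

Definition equiv_ds L M := pair_equiv conj (dsA L) (dsF L) (dsA M) (dsF M).

Lemma equiv_ds_refl L : equiv_ds L L.
Proof. exact: pair_equiv_refl. Qed.

Lemma equiv_ds_sym L M : equiv_ds L M -> equiv_ds M L.
Proof. exact: pair_equiv_sym. Qed.

Lemma equiv_ds_trans L M N : equiv_ds L M -> equiv_ds M N -> equiv_ds L N.
Proof. exact: pair_equiv_trans. Qed.

Lemma equiv_ds_cons s L M : equiv_ds L M -> equiv_ds (s :: L) (s :: M).
Proof. by apply: pair_equiv_block; apply: pair_equiv_refl. Qed.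

Lemma ds_cat L M : pair_equiv conj (dsA (L ++ M)) (dsF (L ++ M))
  (block_mx (dsA L) 0 0 (dsA M)) (block_mx (dsF L) 0 0 (dsF M)).
Proof.
elim: L => [|s L IH] /=.
  exact: pair_equiv_trans (pair_equiv_block0 _ _ _) (pair_equiv_blockC _ _ _ _ _).
apply: pair_equiv_trans (pair_equiv_sym (pair_equiv_blockA _ _ _ _ _ _ _)).
by apply: pair_equiv_block => //; apply: pair_equiv_refl.
Qed.

Lemma equiv_ds_cat L L' M M' :
  equiv_ds L L' -> equiv_ds M M' -> equiv_ds (L ++ M) (L' ++ M').
Proof.
move=> eL eM; apply: pair_equiv_trans (ds_cat L M) _.
exact: pair_equiv_trans (pair_equiv_block eL eM) (pair_equiv_sym (ds_cat _ _)).
Qed.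

Lemma equiv_ds_catC L M : equiv_ds (L ++ M) (M ++ L).
Proof.
apply: pair_equiv_trans (ds_cat L M) _.
exact: pair_equiv_trans (pair_equiv_blockC _ _ _ _ _) (pair_equiv_sym (ds_cat _ _)).
Qed.

Lemma equiv_ds_rot s L M : equiv_ds (L ++ s :: M) (s :: L ++ M).
Proof.
apply: equiv_ds_trans (equiv_ds_catC _ _) _ => /=.
exact/equiv_ds_cons/equiv_ds_catC.
Qed.

(* Weaker than [canon_summand]: the degree of [f] in a type (ii) summand is free. *)
Definition good_summand s :=
  match s with
  | S1 p k => frob_data p k
  | S2 p k f => [/\ frob_data p k, eps = 1, is_Phi1 conj (frob (p ^+ k)) (Phi1 (p ^+ k)),
                    cp f = f & ~~ (p %| f)]
  end.

Fixpoint good L := if L is s :: L' then good_summand s /\ good L' else True.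

Lemma S2_selfadj p k f : good_summand (S2 p k f) -> selfadj conj (sA (S2 p k f)) (sF (S2 p k f)).
Proof.
case=> dp _ phiH cf _; have sa := is_Phi1_selfadj phiH.
rewrite /selfadj /= [RHS]mulmxA -sa -!mulmxA; congr (_ *m _).
by have := pm_comm (frob (p ^+ k)) f 'X; rewrite pmX.
Qed.

Lemma summand_selfadj s : good_summand s -> selfadj conj (sA s) (sF s).
Proof. by case: s => [p k|p k f] gs; [apply: S1_selfadj | apply: S2_selfadj]. Qed.

Lemma summand_unit s : good_summand s -> sF s \in unitmx.
Proof.
case: s => [p k|p k f] gs; first exact: (S1_unit Phi1 eps2 eps_conj).
case: gs => dp _ [uH _] _ nf; rewrite /= unitmx_mul uH pm_frob_unit //.
  exact: frob_data_monic.
by rewrite coprimep_sym; apply: coprimep_expl; apply: irreducible_coprime => //; case: dp => _ [].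
Qed.

Lemma summand_herm s : good_summand s -> ct (sF s) = eps *: sF s.
Proof.
case: s => [p k|p k f] gs; first exact: (S1_herm Phi1 eps2 eps_conj).
case: gs => dp -> phiH cf _; have sa := is_Phi1_selfadj phiH.
case: phiH => _ [hH _]; rewrite scale1r /= ctM hH.
by rewrite (selfadj_pm conj_invol _ sa) cf.
Qed.

Lemma ds_selfadj L : good L -> selfadj conj (dsA L) (dsF L).
Proof.
elim: L => [|s L IH] /= => [_|[gs gL]]; first by rewrite /selfadj !mulmx0.
rewrite /selfadj ct_block !ct0 !mulmx_block !(mul0mx, mulmx0, addr0, add0r).
by rewrite IH // summand_selfadj.
Qed.

Lemma ds_unit L : good L -> dsF L \in unitmx.
Proof.
elim: L => [|s L IH] /= => [_|[gs gL]].
  by rewrite unitmxE det_mx00 unitr1.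
have := summand_unit gs; have := IH gL.
by rewrite !unitmxE det_ublock unitrM => -> ->.
Qed.

Lemma ds_herm L : good L -> ct (dsF L) = eps *: dsF L.
Proof.
elim: L => [|s L IH] /= => [_|[gs gL]]; first by rewrite ct0 scaler0.
by rewrite ct_block !ct0 scale_block_mx !scaler0 IH // summand_herm.
Qed.

(** The vectors are the generators of the type (ii) blocks with polynomial p^k. Past the end of
    [twos], both the vector and the coefficient are 0, so the formula holds for all indices. *)
Lemma ds_generators L p k : frob_data p k -> good L ->
  exists y : nat -> 'cV_(tot L), (forall a, pm (dsA L) (p ^+ k) *m y a = 0) /\
    forall a b h, ct (y a) *m dsF L *m (pm (dsA L) h *m y b) =
      (a == b)%:R *: cyclic_form conj (Phi1 (p ^+ k)) ((twos (p ^+ k) L)`_a * h).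
Proof.
move=> dp; have mc := frob_data_monic dp.
have cyc0 h : cyclic_form conj (Phi1 (p ^+ k)) (0 * h) = 0.
  by rewrite mul0r /cyclic_form pm0 mul0mx mulmx0.
elim: L => [|s L IH] => [_|[gs gL]].
  by exists (fun _ => 0); split=> *; rewrite ?mulmx0 //= nth_nil cyc0 scaler0.
have [y [cy ey]] := IH gL.
have skip : twos (p ^+ k) (s :: L) = twos (p ^+ k) L ->
  exists y : nat -> 'cV_(tot (s :: L)), (forall a, pm (dsA (s :: L)) (p ^+ k) *m y a = 0) /\
    forall a b h, ct (y a) *m dsF (s :: L) *m (pm (dsA (s :: L)) h *m y b) =
      (a == b)%:R *: cyclic_form conj (Phi1 (p ^+ k)) ((twos (p ^+ k) (s :: L))`_a * h).
  move=> ->; exists (fun a => col_mx 0 (y a)); split=> [a|a b h] /=.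
    by rewrite pm_block mul_block_col cy !(mul0mx, mulmx0, addr0) col_mx0.
  rewrite pm_block ct_col ct0 mul_row_block mul_block_col mul_row_col.
  by rewrite !(mul0mx, mulmx0, addr0, add0r) ey.
case: s gs skip => [q l|q l f] gs skip; first exact: skip.
have [e|ne] := eqVneq (q ^+ l) (p ^+ k); last by apply: skip => /=; rewrite (negPf ne).
case: gs => dq e1 phiH cf nf; have [eqp ekl] := frob_data_inj dq dp e; subst q l.
exists (fun a => if a is a'.+1 then col_mx 0 (y a') else col_mx (gen (p ^+ k)) 0); split=> [[|a]|].
- by rewrite /= pm_block mul_block_col pm_frob // !(mul0mx, mulmx0, addr0) col_mx0.
- by rewrite /= pm_block mul_block_col cy !(mul0mx, mulmx0, addr0) col_mx0.
move=> a b h; rewrite /= eqxx pm_block.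
case: a b => [|a] [|b]; rewrite ct_col ct0 mul_row_block mul_block_col mul_row_col;
  rewrite !(mul0mx, mulmx0, addr0, add0r) ?scale0r //.
by rewrite scale1r /cyclic_form pmM !mulmxA.
Qed.

End DirectSums.

(** * Linearity of the functional of a block *)

Section CyclicForm.
Variables (K : fieldType) (conj : {rmorphism K -> K}) (c : {poly K}) (H : 'M[K]_((size c).-1)).
Local Notation form := (cyclic_form conj H).
Local Notation pm := peval_mx.

Lemma cyclic_formD f g : form (f + g) = form f + form g.
Proof. by rewrite /cyclic_form pmD mulmxDl mulmxDr. Qed.

Lemma cyclic_form0 : form 0 = 0.
Proof. by rewrite /cyclic_form pm0 mul0mx mulmx0. Qed.

Lemma cyclic_form_nat (b : bool) f : form (b%:R * f) = b%:R *: form f.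
Proof. by case: b; rewrite ?mul1r ?scale1r // mul0r cyclic_form0 scale0r. Qed.

Lemma cyclic_form_sum I (r : seq I) (P : pred I) (E : I -> {poly K}) :
  form (\sum_(i <- r | P i) E i) = \sum_(i <- r | P i) form (E i).
Proof. exact: (big_morph _ cyclic_formD cyclic_form0). Qed.

Lemma cyclic_form_eqmod f g : c \is monic -> c %| f - g -> form f = form g.
Proof.
move=> mc d; rewrite -[f](subrK g) cyclic_formD -[RHS]add0r; congr (_ + _).
by move: d; rewrite -pm_frob_eq0 // /cyclic_form => /eqP ->; rewrite mul0mx mulmx0.
Qed.

End CyclicForm.

(** * Groups of type (ii) blocks over one Frobenius block *)

Section SameBlock.
Variables (K : fieldType) (conj : {rmorphism K -> K}).
Hypothesis conj_invol : involutive conj.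
Variable (Phi1 : forall c : {poly K}, 'M[K]_((size c).-1)).
Hypothesis two_neq0 : (2%:R : K) != 0.
Local Notation ct := (ct conj).
Local Notation cp := (conj_poly conj).
Local Notation pm := peval_mx.
Local Notation dsA := (dsA conj).
Local Notation dsF := (dsF 1 Phi1).
Local Notation form := (cyclic_form conj).
Local Notation good := (good conj 1 Phi1).
Variables (p : {poly K}) (k : nat).
Hypotheses (dp : frob_data p k) (cpp : cp p = p).
Hypothesis phiH : is_Phi1 conj (frob (p ^+ k)) (Phi1 (p ^+ k)).
Local Notation blocks := (map (S2 p k)).
Implicit Types (f g : {poly K}) (fs gs : seq {poly K}).

Let mc : p ^+ k \is monic. Proof. exact: frob_data_monic. Qed.

Lemma tot_blocks fs : tot (blocks fs) = (size fs * fsz p k)%N.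
Proof. by elim: fs => //= f fs ->; rewrite mulSn. Qed.

Lemma twos_blocks fs : twos (p ^+ k) (blocks fs) = fs.
Proof. by elim: fs => //= f fs ->; rewrite eqxx. Qed.

Lemma good_blocks fs : {in fs, forall f, cp f = f /\ ~~ (p %| f)} -> good (blocks fs).
Proof.
elim: fs => //= f fs IH h; split; last by apply: IH => g gin; apply: h; rewrite in_cons gin orbT.
by have [cf nf] := h f (mem_head _ _); split.
Qed.

Section Columns.
Variables (n : nat) (A F : 'M[K]_n).
Hypotheses (sa : selfadj conj A F) (hF : ct F = F).

(** Recursion on [gs] gives the columns the type of [dsA (blocks gs)], so that the two can be
    multiplied. *)
Fixpoint krylovs (y : nat -> 'cV_n) gs : 'M[K]_(n, tot (blocks gs)) :=
  match gs return 'M[K]_(n, tot (blocks gs)) with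
  | [::] => 0
  | g :: gs' => row_mx (krylov A (y 0%N) (fsz p k)) (krylovs (fun b => y b.+1) gs')
  end.

Lemma krylovs_blocks y gs : (forall b, pm A (p ^+ k) *m y b = 0) ->
  A *m krylovs y gs = krylovs y gs *m dsA (blocks gs).
Proof.
elim: gs y => [|g gs IH] y cy /=; first by rewrite mulmx0 mul0mx.
rewrite mul_mx_row mul_row_block !mulmx0 addr0 add0r IH //.
by rewrite krylov_frob.
Qed.

Lemma krylovs_orthogonal y gs w :
  (forall b f, (b < size gs)%N -> ct w *m F *m (pm A f *m y b) = 0) ->
  ct (krylov A w (fsz p k)) *m F *m krylovs y gs = 0.
Proof.
elim: gs y => [|g gs IH] y e /=; first by rewrite mulmx0.
rewrite mul_mx_row (gram_eq0 conj_invol) // => [|f]; last exact: e.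
by rewrite IH ?row_mx0 // => b f lt; apply: e.
Qed.

Lemma gram_krylovs y gs : {in gs, forall g, cp g = g /\ ~~ (p %| g)} ->
  (forall a b f, (a < size gs)%N -> (b < size gs)%N ->
    ct (y a) *m F *m (pm A f *m y b) = (a == b)%:R *: form (Phi1 (p ^+ k)) (gs`_a * f)) ->
  ct (krylovs y gs) *m F *m krylovs y gs = dsF (blocks gs).
Proof.
elim: gs y => [|g gs IH] y hg e /=; first by rewrite mulmx0.
have orth : ct (krylov A (y 0%N) (fsz p k)) *m F *m krylovs (fun b => y b.+1) gs = 0.
  by apply: krylovs_orthogonal => b f lt; rewrite e //= scale0r.
have orth' : ct (krylovs (fun b => y b.+1) gs) *m F *m krylov A (y 0%N) (fsz p k) = 0.
  by apply: (ct_inj conj_invol); rewrite !ctM ctK // hF mulmxA orth ct0.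
rewrite ct_row mul_col_mx mul_col_row orth orth' IH; first last.
- by move=> a b f la lb; rewrite e.
- by move=> g' g'in; apply: hg; rewrite in_cons g'in orbT.
congr (block_mx _ _ _ _).
have gg : good_summand conj 1 Phi1 (S2 p k g) by have [] := hg g (mem_head _ _); split.
(* The comparison is with [gen] in the block itself: it has the same functional, and its Krylov
   matrix is the identity. *)
rewrite (eq_gram conj_invol (w' := gen _) (v' := gen _) _ _ sa (S2_selfadj gg)) => [|f].
  by rewrite krylov_gen ct1 mul1mx mulmx1.
by rewrite e //= scale1r /cyclic_form pmM !mulmxA.
Qed.

End Columns.

Lemma blocks_equiv fs gs :
  {in fs, forall f, cp f = f /\ ~~ (p %| f)} -> {in gs, forall g, cp g = g /\ ~~ (p %| g)} ->
  herm_equiv conj p fs gs -> equiv_ds conj 1 Phi1 (blocks fs) (blocks gs).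
Proof.
move=> hfs hgs he; have ip : irreducible_poly p by case: dp => _ [].
have [|T eT] := herm_hensel conj_invol two_neq0 k ip cpp _ hgs he.
  by move=> f /hfs [].
have sz : size fs = size gs by case: he.
have gfs := good_blocks hfs; have ggs := good_blocks hgs.
have eps2 : (1 : K) * 1 = 1 by rewrite mulr1.
have sa := ds_selfadj conj_invol gfs.
have [y [cy ey]] := ds_generators dp gfs.
pose z b := \sum_(a < size fs) pm (dsA (blocks fs)) (T a b) *m y a.
have cz b : pm (dsA (blocks fs)) (p ^+ k) *m z b = 0.
  by rewrite mulmx_sumr big1 // => a _; rewrite mulmxA pm_comm -mulmxA cy mulmx0.
have ez i j f : (i < size gs)%N -> (j < size gs)%N ->
    ct (z i) *m dsF (blocks fs) *m (pm (dsA (blocks fs)) f *m z j) =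
    (i == j)%:R *: form (Phi1 (p ^+ k)) (gs`_i * f).
  rewrite -sz => li lj.
  (* The functional depends only on classes modulo p^k, so the lifted congruence for T can be
     substituted inside it. *)
  rewrite -cyclic_form_nat mulrA -(cyclic_form_eqmod conj (Phi1 (p ^+ k)) mc
    (f := (\sum_(a < size fs) fs`_a * cp (T a i) * T a j) * f)); last first.
    by rewrite -mulrBl dvdp_mulr // eT.
  rewrite mulr_suml cyclic_form_sum.
  have -> : ct (z i) = \sum_(a < size fs) ct (pm (dsA (blocks fs)) (T a i) *m y a).
    by apply: (big_morph _ (@ctD _ conj _ _) (ct0 _ _ _)).
  have -> : pm (dsA (blocks fs)) f *m z j = \sum_(b < size fs) pm (dsA (blocks fs)) (f * T b j) *m y b.
    by rewrite mulmx_sumr; apply: eq_bigr => b _; rewrite pmM mulmxA.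
  rewrite 2!mulmx_suml; apply: eq_bigr => a _.
  rewrite [LHS]mulmx_sumr (bigD1 a) //= [X in _ + X]big1 => [|b nb].
    rewrite addr0 (selfadj_shift conj_invol) // [pm _ _ *m (_ *m _)]mulmxA -pmM ey eqxx scale1r twos_blocks.
    by congr (form _ _); rewrite !mulrA; ring.
  rewrite (selfadj_shift conj_invol) // [pm _ _ *m (_ *m _)]mulmxA -pmM ey.
  by rewrite -val_eqE eq_sym /= in nb; rewrite (negPf nb) scale0r.
apply: (@embed_pair_equiv _ _ _ _ _ _ _ _ (krylovs (dsA (blocks fs)) z gs)).
- by rewrite !tot_blocks sz.
- by apply: (ds_unit eps2 (rmorph1 conj) ggs).
- exact: krylovs_blocks.
- by apply: gram_krylovs => //; rewrite (ds_herm conj_invol eps2 (rmorph1 conj) gfs) scale1r.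
Qed.

End SameBlock.

(** * Coordinates of torsion vectors *)

Section Coordinates.
Variables (K : fieldType) (conj : {rmorphism K -> K}).
Hypothesis conj_invol : involutive conj.
Variable (Phi1 : forall c : {poly K}, 'M[K]_((size c).-1)).
Hypothesis two_neq0 : (2%:R : K) != 0.
Local Notation ct := (ct conj).
Local Notation cp := (conj_poly conj).
Local Notation pm := peval_mx.
Local Notation dsA := (dsA conj).
Local Notation dsF := (dsF 1 Phi1).
Local Notation form := (cyclic_form conj).
Local Notation good := (good conj 1 Phi1).
Implicit Types (f g h p q : {poly K}) (L : seq (summand K)).

(** Converse of [Phi1_exists_cp]: for eps = 1 and [cp p = p], polarization of the isotropic pair in
    a type (i) block yields a vector whose Gram matrix is a [Phi1]. *)
Lemma S1_Phi1_exists p k : frob_data p k -> cp p = p -> Phi1_exists conj (p ^+ k).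
Proof.
move=> dp cpp.
have [w [v [cw cv nz _ _]]] :=
  S1_isotropic_pair conj (eps := 1) Phi1 (mulr1 1) dp.
rewrite rmorphXn /= cpp in cv nz.
have hF := S1_herm (eps := 1) Phi1 (mulr1 1) (rmorph1 conj) p k.
rewrite scale1r in hF.
have sa := S1_selfadj conj_invol 1 Phi1 p k.
have [z cz nz'] := ex_anisotropic conj_invol two_neq0 hF sa cpp cw cv nz.
set Z := krylov (sA conj (S1 p k)) z (fsz p k).
by exists (ct Z *m sF 1 Phi1 (S1 p k) *m Z); apply: gram_is_Phi1.
Qed.

(** If l < k, then p^(k-1) already kills the block. If l > k, torsion vectors are multiples of
    p^(l-k), and the total exponent 2(l-k) + k-1 is at least l. *)
Lemma frob_ann_other_degree p k l F g (y z : 'cV_(fsz p l)) : frob_data p k -> frob_data p l -> cp p = p ->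
  k != l -> selfadj conj (frob (p ^+ l)) F ->
  pm (frob (p ^+ l)) (p ^+ k) *m y = 0 -> pm (frob (p ^+ l)) (p ^+ k) *m z = 0 ->
  ct y *m F *m (pm (frob (p ^+ l)) (p ^+ k.-1 * g) *m z) = 0.
Proof.
move=> dp dl cpp nkl sa cy cz; have ml := frob_data_monic dl.
have p0 : p != 0 by apply: irredp_neq0; case: dp => _ [].
have k0 : (0 < k)%N by case: dp => _ [].
case: (ltngtP k l) nkl => // [lt|lt] _; last first.
  have -> : pm (frob (p ^+ l)) (p ^+ k.-1 * g) = 0.
    by apply/eqP; rewrite pm_frob_eq0 // dvdp_mulr // dvdp_exp2l //; lia.
  by rewrite mul0mx mulmx0.
have [fy _ ey] := frob_gen_span y; have [fz _ ez] := frob_gen_span z; subst y z.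
have div h : pm (frob (p ^+ l)) (p ^+ k) *m (pm (frob (p ^+ l)) h *m gen _) = 0 ->
    exists h', h = h' * p ^+ (l - k).
  rewrite mulmxA -pmM => /eqP; rewrite pm_frob_gen_eq0 // -{1}(subnKC (ltnW lt)) exprD.
  by rewrite dvdp_mul2l ?expf_neq0 // => /dvdpP.
have [y' ->] := div _ cy; have [z' ->] := div _ cz.
rewrite (selfadj_shift conj_invol) // [X in _ *m X = _]mulmxA -pmM [X in _ *m X = _]mulmxA -pmM.
have -> : pm (frob (p ^+ l)) (cp (y' * p ^+ (l - k)) * (p ^+ k.-1 * g) * (z' * p ^+ (l - k))) = 0.
  apply/eqP; rewrite pm_frob_eq0 // rmorphM rmorphXn /= cpp.
  have -> : cp y' * p ^+ (l - k) * (p ^+ k.-1 * g) * (z' * p ^+ (l - k)) =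
    (p ^+ (l - k) * p ^+ k.-1 * p ^+ (l - k)) * (cp y' * g * z') by ring.
  by rewrite dvdp_mulr // -!exprD dvdp_exp2l //; lia.
by rewrite mul0mx mulmx0.
Qed.

Lemma coprime_ann n (A : 'M[K]_n) c d (z : 'cV_n) : coprimep c d -> pm A c = 0 ->
  pm A d *m z = 0 -> z = 0.
Proof.
case/Bezout_eq1_coprimepP => [[u v] /= e] c0 dz.
by rewrite -[z]mul1mx -(pm1 A) -e pmD !pmM c0 mulmx0 add0r -mulmxA dz mulmx0.
Qed.

(* [S] reads off the coordinates of a [p ^+ k]-torsion vector on the blocks of
   degree exactly [k]; the other blocks do not contribute to [F(y, p^(k-1) z)]. *)
Lemma ds_coordinates L p k : frob_data p k -> cp p = p -> canon conj 1 L -> good L ->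
  exists S : 'cV_(tot L) -> nat -> {poly K}, forall y z g,
    pm (dsA L) (p ^+ k) *m y = 0 -> pm (dsA L) (p ^+ k) *m z = 0 ->
    ct y *m dsF L *m (pm (dsA L) (p ^+ k.-1 * g) *m z) =
    \sum_(a < size (twos (p ^+ k) L))
      form (Phi1 (p ^+ k)) ((twos (p ^+ k) L)`_a * cp (S y a) * S z a * (p ^+ k.-1 * g)).
Proof.
move=> dp cpp; have mc := frob_data_monic dp.
elim: L => [|s L IH] => [_ _|[cs cL] [gs gL]].
  by exists (fun _ _ => 0) => y z g _ _; rewrite big_ord0 /= mulmx0 mul0mx.
have [S eS] := IH cL gL.
have blk y z g : ct y *m dsF (s :: L) *m (pm (dsA (s :: L)) g *m z) =
    ct (usubmx y) *m sF 1 Phi1 s *m (pm (sA conj s) g *m usubmx z) +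
    ct (dsubmx y) *m dsF L *m (pm (dsA L) g *m dsubmx z).
  rewrite -{1}[y]vsubmxK -{1}[z]vsubmxK /= pm_block ct_col mul_row_block mul_block_col.
  by rewrite !(mul0mx, mulmx0, addr0, add0r) mul_row_col.
have ann y : pm (dsA (s :: L)) (p ^+ k) *m y = 0 ->
    pm (sA conj s) (p ^+ k) *m usubmx y = 0 /\ pm (dsA L) (p ^+ k) *m dsubmx y = 0.
  rewrite -{1}[y]vsubmxK /= pm_block mul_block_col !(mul0mx, mulmx0, addr0, add0r).
  by rewrite -[0](@col_mx0 K) => /eq_col_mx.
have skip : twos (p ^+ k) (s :: L) = twos (p ^+ k) L ->
  (forall (y z : 'cV_(ssize s)) g, pm (sA conj s) (p ^+ k) *m y = 0 -> pm (sA conj s) (p ^+ k) *m z = 0 ->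
     ct y *m sF 1 Phi1 s *m (pm (sA conj s) (p ^+ k.-1 * g) *m z) = 0) ->
  exists S : 'cV_(tot (s :: L)) -> nat -> {poly K}, forall y z g,
    pm (dsA (s :: L)) (p ^+ k) *m y = 0 -> pm (dsA (s :: L)) (p ^+ k) *m z = 0 ->
    ct y *m dsF (s :: L) *m (pm (dsA (s :: L)) (p ^+ k.-1 * g) *m z) =
    \sum_(a < size (twos (p ^+ k) (s :: L)))
      form (Phi1 (p ^+ k)) ((twos (p ^+ k) (s :: L))`_a * cp (S y a) * S z a * (p ^+ k.-1 * g)).
  move=> -> s0; exists (fun y => S (dsubmx y)) => y z g /ann [cy1 cy2] /ann [cz1 cz2].
  by rewrite blk s0 // add0r eS.
case: s cs gs blk ann skip => [q l|q l f] cs gs blk ann skip.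
  apply: skip => // y z g cy cz; suff -> : z = 0 by rewrite !mulmx0.
  (* By [S1_Phi1_exists], q = p would contradict canonicity; so the annihilator of the block is
     prime to p^k and it has no p^k-torsion. *)
  case: cs => dq /(_ erefl) nex; apply: coprime_ann cz; last exact: (S1_ann conj dq).
  have npq : q != p by apply/eqP => eqp; apply: nex; apply: S1_Phi1_exists => //; rewrite eqp.
  rewrite rmorphXn /= coprimepMl (frob_data_coprime dq dp npq).
  apply: (frob_data_coprime (cp_frob_data conj_invol dq) dp).
  by apply: contraNneq npq => e; rewrite -[q](cpK conj_invol) e cpp.
case: (gs) => dq _ phiH cf nf.
have [eqp|nqp] := eqVneq q p; last first.
  apply: skip => [|y z g cy cz] /=.
    by case: eqP => // e; case: (frob_data_inj dq dp e) => e'; rewrite e' eqxx in nqp.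
  suff -> : z = 0 by rewrite !mulmx0.
  apply: coprime_ann cz; last exact: (pm_frob (frob_data_monic dq)).
  exact: frob_data_coprime.
subst q; have [ekl|nkl] := eqVneq k l; last first.
  apply: skip => [|y z g cy cz] /=.
    by case: eqP => // e; case: (frob_data_inj dq dp e) => _ e'; rewrite e' eqxx in nkl.
  by apply: frob_ann_other_degree => //; apply: S2_selfadj gs.
(* The new coordinate is the polynomial that carries [gen] to the component of y in this block. *)
subst l; exists (fun y a => if a is a'.+1 then S (dsubmx y) a' else rVpoly (usubmx y)^T).
move=> y z g /ann [cy1 cy2] /ann [cz1 cz2]; rewrite blk eS //= eqxx big_ord_recl /=.
congr (_ + _).
have coord (u : 'cV_(fsz p k)) : u = pm (frob (p ^+ k)) (rVpoly u^T) *m gen _.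
  by rewrite -krylov_mulv krylov_gen mul1mx.
rewrite {1}[usubmx y]coord {1}[usubmx z]coord (selfadj_shift conj_invol _ _ _ (S2_selfadj gs)).
rewrite /cyclic_form /=; move: (rVpoly _) (rVpoly _) (p ^+ k.-1 * g) => v u h.
have -> : f * cp u * v * h = f * (cp u * (h * v)) by ring.
by rewrite !pmM !mulmxA.
Qed.

End Coordinates.

(** * Invariance of the Hermitian forms modulo p *)

Section InvarianceOfForms.
Variables (K : fieldType) (conj : {rmorphism K -> K}).
Hypothesis conj_invol : involutive conj.
Variable (Phi1 : forall c : {poly K}, 'M[K]_((size c).-1)).
Hypothesis two_neq0 : (2%:R : K) != 0.
Local Notation cp := (conj_poly conj).
Local Notation pm := peval_mx.
Local Notation dsA := (dsA conj).
Local Notation dsF := (dsF 1 Phi1).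
Local Notation form := (cyclic_form conj).
Implicit Types (f g h p q : {poly K}) (L : seq (summand K)).

Lemma twos_good eps L p k : frob_data p k -> good conj eps Phi1 L ->
  {in twos (p ^+ k) L, forall f, cp f = f /\ ~~ (p %| f)}.
Proof.
move=> dp; elim: L => [|[q l|q l f] L IH] //= [gs gL]; first exact: IH.
case: eqP => [e|_]; last exact: IH.
case: gs => dq _ _ cf nf; have [eqp _] := frob_data_inj dq dp e; subst q.
by move=> f'; rewrite in_cons => /orP[/eqP ->|]; [|apply: IH].
Qed.

Lemma det_congr s (M N : 'M[{poly K}]_s) p : (forall i j, p %| M i j - N i j) ->
  p %| \det M - \det N.
Proof.
move=> e; apply: (big_ind2 (fun x y => p %| x - y)) => [|x y x' y' d d'|t _].
- by rewrite subrr dvdp0.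
- by rewrite opprD addrACA dvdp_add.
- rewrite -mulrBr dvdp_mull //.
  apply: (big_ind2 (fun x y => p %| x - y)) => [|x y x' y' d d'|i _] //.
    by rewrite subrr dvdp0.
  have -> : x * x' - y * y' = (x - y) * x' + y * (x' - y') by ring.
  by apply: dvdp_add; [apply: dvdp_mulr | apply: dvdp_mull].
Qed.

Lemma pair_equiv_intertwine m n (A1 F1 : 'M[K]_m) (A2 F2 : 'M[K]_n) :
  pair_equiv conj A1 F1 A2 F2 ->
  exists P : 'M_(m, n), A1 *m P = P *m A2 /\ ct conj P *m F1 *m P = F2.
Proof.
case=> P [Q [QP [PQ [-> ->]]]]; exists P; split=> //.
by rewrite !mulmxA PQ mul1mx.
Qed.

Lemma equiv_herm L1 L2 p k : frob_data p k -> cp p = p ->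
  is_Phi1 conj (frob (p ^+ k)) (Phi1 (p ^+ k)) ->
  canon conj 1 L1 -> good conj 1 Phi1 L1 -> good conj 1 Phi1 L2 ->
  size (twos (p ^+ k) L1) = size (twos (p ^+ k) L2) ->
  equiv_ds conj 1 Phi1 L1 L2 ->
  herm_equiv conj p (twos (p ^+ k) L1) (twos (p ^+ k) L2).
Proof.
move=> dp cpp phiH c1 g1 g2 sz /pair_equiv_intertwine [P [eA eF]].
have mc := frob_data_monic dp; have ip : irreducible_poly p by case: dp => _ [].
have k0 : (0 < k)%N by case: dp => _ [].
have [S eS] := ds_coordinates conj_invol two_neq0 dp cpp c1 g1.
have [y [cy ey]] := ds_generators dp g2.
pose z b := P *m y b.
have cz b : pm (dsA L1) (p ^+ k) *m z b = 0.
  by rewrite mulmxA (pm_intertwine _ eA) -mulmxA cy mulmx0.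
set fs := twos _ L1 in sz eS *; set gs := twos _ L2 in sz ey *; set s := size fs in sz eS *.
(* Equal values at p^(k-1) g for all g give, by nondegeneracy of the functional, a congruence modulo
   p^k of multiples of p^(k-1), hence one modulo p. *)
have key i j : p %| \sum_(a < s) fs`_a * cp (S (z i) a) * S (z j) a - (i == j)%:R * gs`_i.
  have pk : p ^+ k = p * p ^+ k.-1 by rewrite -exprS prednK.
  rewrite -(dvdp_mul2r _ _ (expf_neq0 k.-1 (irredp_neq0 ip))) -pk.
  apply: (cyclic_form_nondeg conj_invol mc phiH) => g.
  have := eS (z i) (z j) g (cz i) (cz j).
  have isom u v : ct conj (P *m u) *m dsF L1 *m (P *m v) = ct conj u *m dsF L2 *m v.
    by rewrite ctM -eF !mulmxA.
  rewrite /z [pm (dsA L1) _ *m (P *m _)]mulmxA (pm_intertwine _ eA) -[P *m _ *m y j]mulmxA isom ey.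
  rewrite -cyclic_form_nat -cyclic_form_sum => e.
  have -> : (\sum_(a < s) fs`_a * cp (S (P *m y i) a) * S (P *m y j) a - (i == j)%:R * gs`_i) * p ^+ k.-1 * g =
     \sum_(a < s) fs`_a * cp (S (P *m y i) a) * S (P *m y j) a * (p ^+ k.-1 * g) - (i == j)%:R * (gs`_i * (p ^+ k.-1 * g)).
    by rewrite -mulr_suml; ring.
  by rewrite (cyclic_formD conj) -e -cyclic_formD subrr cyclic_form0.
pose Sm : 'M[{poly K}]_s := \matrix_(a, b) S (z b) a.
pose D : 'M[{poly K}]_s := \matrix_(a < s, b < s) ((a == b)%:R * fs`_a).
have eSD (i j : 'I_s) : (map_mx cp Sm^T *m D *m Sm) i j = \sum_(a < s) fs`_a * cp (S (z i) a) * S (z j) a.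
  rewrite -mulmxA mxE; apply: eq_bigr => a _; rewrite [(D *m Sm) a j]mxE (bigD1 a) //= big1 => [|b].
    by rewrite !mxE eqxx mul1r addr0 mulrCA mulrA.
  by rewrite !mxE eq_sym => /negPf ->; rewrite !mul0r.
have cong (i j : 'I_s) : p %| (map_mx cp Sm^T *m D *m Sm) i j - (i == j)%:R * gs`_i.
  by rewrite eSD -val_eqE key.
(* If p divided the determinant of [Sm], it would divide the product of [gs], whose factors are all
   prime to p. *)
split=> //; exists Sm; split=> //; apply/negP => d.
have := @det_congr s (map_mx cp Sm^T *m D *m Sm) (diag_mx (\row_i gs`_i)) p.
have dd : p %| \det (map_mx cp Sm^T *m D *m Sm) by rewrite det_mulmx dvdp_mull.
rewrite dvdp_subr // det_diag => H.
have : p %| \prod_(i < s) (\row_i gs`_i) 0 i.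
  by apply: H => i j; rewrite !mxE mulrb in cong *; have := cong i j; rewrite !mxE; case: eqP => [->|]; rewrite ?mul1r ?mul0r.
apply/negP; apply: (big_ind (fun x => ~~ (p %| x))) => [|x x' nx nx'|i _].
- by rewrite dvdp1; case: ip => sp _; rewrite neq_ltn sp orbT.
- by rewrite irreducible_dvdp_mul // negb_or nx.
- by rewrite mxE; have [] := twos_good dp g2 (mem_nth 0 (_ : (i < size gs)%N)); rewrite -?sz.
Qed.

End InvarianceOfForms.

(** * Block multiplicities from ranks *)

Section Ranks.
Variables (K : fieldType) (conj : {rmorphism K -> K}).
Hypothesis conj_invol : involutive conj.
Local Notation ct := (ct conj).
Local Notation cp := (conj_poly conj).
Local Notation pm := peval_mx.
Implicit Types (f g h p q c : {poly K}) (L : seq (summand K)).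

Lemma leq_rank_col n a b (B : 'M[K]_(n, a)) (M : 'M_(n, b)) :
  (forall u : 'cV_a, exists w, B *m u = M *m w) -> (\rank B <= \rank M)%N.
Proof.
move=> e; rewrite -mxrank_tr -[X in (_ <= X)%N]mxrank_tr; apply/mxrankS/row_subP => i.
have [w ew] := e (delta_mx i 0).
by apply/submxP; exists w^T; rewrite -trmx_mul -ew -colE tr_col.
Qed.

Lemma rank_col_inj n b (M : 'M[K]_(n, b)) :
  (forall u : 'cV_b, M *m u = 0 -> u = 0) -> \rank M = b.
Proof.
move=> inj; rewrite -mxrank_tr; apply/eqP; rewrite -[_ == _]/(row_free M^T) -kermx_eq0.
apply/eqP/row_matrixP => i; rewrite row0; apply: trmx_inj; rewrite trmx0; apply: inj.
by apply: trmx_inj; rewrite trmx_mul trmxK trmx0; apply/sub_kermxP; apply: row_sub.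
Qed.

(** The image of p^j(Phi) is the cyclic space of p^j(Phi) gen, isomorphic to K[x]/p^(l-j). Truncated
    subtraction covers j > l. *)
Lemma rank_pm_frob p l j : frob_data p l ->
  \rank (pm (frob (p ^+ l)) (p ^+ j)) = ((size p).-1 * (l - j))%N.
Proof.
move=> dp; have mc := frob_data_monic dp; case: (dp) => mp [ip _].
set Phi := frob (p ^+ l).
have [lt|le] := ltnP l j.
  have -> : pm Phi (p ^+ j) = 0 by apply/eqP; rewrite pm_frob_eq0 // dvdp_exp2l // ltnW.
  by rewrite mxrank0 (eqP (ltnW lt : (l - j == 0)%N)) muln0.
set m := (_ * _)%N; set M := krylov Phi (pm Phi (p ^+ j) *m gen _) m.
have eM : M = pm Phi (p ^+ j) *m krylov Phi (gen _) m.
  by apply: krylov_intertwine; have := pm_comm Phi 'X (p ^+ j); rewrite pmX.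
have mr : p ^+ (l - j) \is monic by apply: monic_exp.
have eql : p ^+ l = p ^+ (l - j) * p ^+ j by rewrite -exprD subnK.
have pj0 : p ^+ j != 0 by rewrite expf_neq0 ?irredp_neq0.
have szr : size (p ^+ (l - j)) = m.+1 by apply: size_monic_exp.
transitivity (\rank M); last first.
  apply: rank_col_inj => u; rewrite krylov_mulv mulmxA -pmM => /eqP.
  rewrite pm_frob_gen_eq0 // eql dvdp_mul2r // => d.
  apply: trmx_inj; rewrite trmx0 -[u^T]rVpolyK.
  suff -> : rVpoly u^T = 0 by rewrite linear0.
  by rewrite -(modp_small (p := rVpoly u^T) (q := p ^+ (l - j))) ?(eqP d) // szr ltnS size_poly.
apply/eqP; rewrite eqn_leq {2}eM mxrankM_maxl andbT; apply: leq_rank_col => u.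
have [f _ ->] := frob_gen_span u.
exists (poly_rV (f %% p ^+ (l - j)))^T; rewrite -krylov_poly; last first.
  by rewrite -ltnS -szr ltn_modp monic_neq0.
rewrite !mulmxA -!pmM {1}(divp_eq f (p ^+ (l - j))) mulrDr pmD mulmxDl [_ * p ^+ j]mulrC.
rewrite -[RHS]add0r; congr (_ + _); apply/eqP; rewrite pm_frob_gen_eq0 //.
by rewrite eql mulrCA dvdp_mull // mulrC.
Qed.

Lemma rank_pm_ct n (M : 'M[K]_n) f : \rank (pm (ct M) f) = \rank (pm M (cp f)).
Proof. by rewrite -{1}[f](cpK conj_invol) -pm_ct /Defs.ct mxrank_map mxrank_tr. Qed.

Lemma rank_pm_equiv m n (A1 F1 : 'M[K]_m) (A2 F2 : 'M[K]_n) f :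
  pair_equiv conj A1 F1 A2 F2 -> \rank (pm A1 f) = \rank (pm A2 f).
Proof.
have le a b (B1 G1 : 'M[K]_a) (B2 G2 : 'M[K]_b) :
    pair_equiv conj B1 G1 B2 G2 -> (\rank (pm B2 f) <= \rank (pm B1 f))%N.
  case=> P [Q [QP [PQ [e _]]]].
  have eA : B1 *m P = P *m B2 by rewrite e !mulmxA PQ mul1mx.
  have -> : pm B2 f = Q *m pm B1 f *m P by rewrite -mulmxA (pm_intertwine _ eA) mulmxA QP mul1mx.
  exact: leq_trans (mxrankM_maxl _ _) (mxrankM_maxr _ _).
by move=> e; apply/eqP; rewrite eqn_leq (le _ _ _ _ _ _ e) (le _ _ _ _ _ _ (pair_equiv_sym e)).
Qed.

(* Second difference in [j] of the rank of [p^j], which isolates the blocks of degree exactly [k]. *)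
Lemma rank_frob_diff p q k l : frob_data p k -> frob_data q l ->
  (\rank (pm (frob (q ^+ l)) (p ^+ k.-1)) + \rank (pm (frob (q ^+ l)) (p ^+ k.+1)) =
   (\rank (pm (frob (q ^+ l)) (p ^+ k))).*2 + (size p).-1 * (q ^+ l == p ^+ k))%N.
Proof.
move=> dp dq; have [e|npq] := eqVneq q p.
  subst q; rewrite !rank_pm_frob //; have k0 : (0 < k)%N by case: dp => _ [].
  have -> : (p ^+ l == p ^+ k) = (l == k).
    by apply/eqP/eqP => [/(frob_data_inj dq dp) []|->].
  rewrite -muln2 -mulnA -!mulnDr; congr (_ * _)%N.
  by case: eqP => /= ?; lia.
have full j : \rank (pm (frob (q ^+ l)) (p ^+ j)) = (size (q ^+ l)).-1.
  apply: mxrank_unit; apply: pm_frob_unit; first exact: frob_data_monic.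
  rewrite coprimep_sym; apply: coprimep_expr; have := frob_data_coprime dq (l := 1) (q := p).
  by rewrite expr1; apply => //; case: dp => ? [].
rewrite !full addnn; case: eqP => [/(frob_data_inj dq dp) [e _]|_]; first by rewrite e eqxx in npq.
by rewrite muln0 addn0.
Qed.

(** A type (i) block contains Phi and its conjugate transpose; the latter contributes to p what Phi
    contributes to [cp p]. So ranks see only the sum of the two counts, which is the ambiguity
    allowed for type (i). *)
Lemma rank_ds_diff eps L p k : frob_data p k -> canon conj eps L ->
  (\rank (pm (dsA conj L) (p ^+ k.-1)) + \rank (pm (dsA conj L) (p ^+ k.+1)) =
   (\rank (pm (dsA conj L) (p ^+ k))).*2 + (size p).-1 *
     (count_mem (p ^+ k) (ones L) + count_mem (cp (p ^+ k)) (ones L) + size (twos (p ^+ k) L)))%N.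
Proof.
move=> dp; elim: L => [|s L IH] /= => [_|[cs cL]]; first by rewrite ![pm 0 _]flatmx0 !mxrank0 !muln0.
rewrite !pm_block !rank_diag_block_mx; have := IH cL.
have cdp := cp_frob_data conj_invol dp.
case: s cs => [q l|q l f] [dq cs] /= e.
  rewrite !pm_block !rank_diag_block_mx !rank_pm_ct.
  have := rank_frob_diff dp dq; have := rank_frob_diff cdp dq.
  rewrite !rmorphXn /= size_cp in e *.
  move: e; rewrite !mulnDr -!muln2.
  do 9!(move: (\rank _) => ?); do 5!(move: ((size p).-1 * _)%N => ?); lia.
have := rank_frob_diff dp dq; move: e.
case: eqP => _; rewrite !mulnDr -!muln2 /= ?mulnS ?muln1 ?muln0;
  do 6!(move: (\rank _) => ?); do 3!(move: ((size p).-1 * _)%N => ?); lia.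
Qed.

End Ranks.

(** * Uniqueness: equivalence of canonical sums *)

Section Uniqueness.
Variables (K : fieldType) (conj : {rmorphism K -> K}).
Hypothesis conj_invol : involutive conj.
Variables (eps : K) (Phi1 : forall c : {poly K}, 'M[K]_((size c).-1)).
Hypothesis eps_pm1 : eps = 1 \/ eps = -1.
Hypothesis eps_nonid : (exists a : K, conj a != a) -> eps = 1.
Hypothesis two_neq0 : (2%:R : K) != 0.
Hypothesis Phi1_spec : forall (p : {poly K}) (k : nat), frob_data p k ->
  Phi1_exists conj (p ^+ k) -> is_Phi1 conj (frob (p ^+ k)) (Phi1 (p ^+ k)).
Local Notation cp := (conj_poly conj).
Local Notation pm := peval_mx.
Local Notation canon := (canon conj eps).
Local Notation good := (good conj eps Phi1).
Local Notation equiv_ds := (equiv_ds conj eps Phi1).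
Implicit Types (f g h p q c d : {poly K}) (L : seq (summand K)).

Lemma eps_sqr : eps * eps = 1.
Proof. by case: eps_pm1 => ->; rewrite ?mulrNN mulr1. Qed.

Lemma eps_conj : conj eps = eps.
Proof. by case: eps_pm1 => ->; rewrite ?rmorphN rmorph1. Qed.

Lemma conj_id : eps <> 1 -> forall a, conj a = a.
Proof. by move=> e a; apply/eqP/negPn/negP => na; apply: e; apply: eps_nonid; exists a. Qed.

Lemma cp_id : eps <> 1 -> forall f, cp f = f.
Proof. by move=> e f; apply/polyP => i; rewrite coef_cp conj_id. Qed.

Lemma canon_good L : canon L -> good L.
Proof.
elim: L => [|[p k|p k f] L IH] //= [cs /IH gL]; split=> //; first by case: cs.
case: cs => dp [-> [ex [f0 [cf sf]]]]; split=> //; first exact: Phi1_spec.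
by rewrite gtNdvdp.
Qed.

Lemma canon_cat L M : canon (L ++ M) <-> canon L /\ canon M.
Proof. by elim: L => [|s L IH] /=; tauto. Qed.

Lemma ones_cat L M : ones (L ++ M) = ones L ++ ones M.
Proof. by elim: L => [|[p k|p k f] L IH] //=; rewrite IH. Qed.

Lemma twos_cat c L M : twos c (L ++ M) = twos c L ++ twos c M.
Proof. by elim: L => [|[p k|p k f] L IH] //=; rewrite IH //; case: eqP. Qed.

Lemma ones_frob_data L d : canon L -> d \in ones L -> exists p k, frob_data p k /\ d = p ^+ k.
Proof.
elim: L => [|[p k|p k f] L IH] //= [cs cL]; last exact: IH.
by rewrite in_cons => /orP[/eqP ->|]; [exists p, k; case: cs | apply: IH].
Qed.

(** With [ones_nil], shows that for each p^k only one type occurs, so that the mixed count obtained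
    from ranks determines both. *)
Lemma twos_nil L p k : canon L -> frob_data p k -> eps <> 1 \/ cp p <> p -> twos (p ^+ k) L = [::].
Proof.
move=> cL dp ne; elim: L cL => [|[q l|q l f] L IH] //= [cs cL]; first exact: IH.
case: eqP => [e|_]; last exact: IH.
case: cs => dq [e1 [ex _]]; have [eqp _] := frob_data_inj dq dp e.
by case: ne => [[] //|[]]; rewrite -eqp; apply: (Phi1_exists_cp conj_invol dq ex).
Qed.

Lemma ones_nil L p k : canon L -> frob_data p k -> eps = 1 -> cp p = p ->
  count_mem (p ^+ k) (ones L) = 0%N.
Proof.
move=> cL dp e1 cpp; apply/count_memPn; elim: L cL => [|[q l|q l f] L IH] //= [cs cL]; last exact: IH.
rewrite in_cons negb_or IH // andbT; apply/eqP => e.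
case: cs => dq /(_ e1) []; have [<- <-] := frob_data_inj dp dq e.
exact: (S1_Phi1_exists conj_invol Phi1).
Qed.

Lemma herm_equiv_nil p : irreducible_poly p -> herm_equiv conj p [::] [::].
Proof.
case=> sp _; split=> //; exists 1%:M; split=> [|[]] //.
by rewrite det1 dvdp1 neq_ltn sp orbT.
Qed.

Lemma equiv_canon_rel L1 L2 : canon L1 -> canon L2 -> equiv_ds L1 L2 -> canon_rel conj L1 L2.
Proof.
move=> c1 c2 eL.
have cnt p k : frob_data p k ->
    (count_mem (p ^+ k) (ones L1) + count_mem (cp (p ^+ k)) (ones L1) + size (twos (p ^+ k) L1) =
     count_mem (p ^+ k) (ones L2) + count_mem (cp (p ^+ k)) (ones L2) + size (twos (p ^+ k) L2))%N.
  move=> dp; have := rank_ds_diff conj_invol dp c1; have := rank_ds_diff conj_invol dp c2.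
  rewrite !(rank_pm_equiv _ eL) => -> /addnI /eqP.
  by rewrite eqn_pmul2l ?(frob_data_deg dp) // => /eqP.
split=> [c|p k dp]; last first.
  have [e1|ne] := classic (eps = 1); last first.
    rewrite (twos_nil c1 dp (or_introl ne)) (twos_nil c2 dp (or_introl ne)).
    by apply: herm_equiv_nil; case: dp => _ [].
  have [cpp|ne] := classic (cp p = p); last first.
    rewrite (twos_nil c1 dp (or_intror ne)) (twos_nil c2 dp (or_intror ne)).
    by apply: herm_equiv_nil; case: dp => _ [].
  have phiH := Phi1_spec dp (S1_Phi1_exists conj_invol Phi1 two_neq0 dp cpp).
  have := cnt _ _ dp; rewrite rmorphXn /= cpp !ones_nil // => sz.
  have g1 := canon_good c1; have g2 := canon_good c2; move: c1 c2 g1 g2 eL; rewrite e1 => c1 c2 g1 g2 eL.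
  exact: (equiv_herm conj_invol two_neq0 dp cpp phiH c1 g1 g2).
have [[p [k [dp ec]]]|nc] := classic (exists p k, frob_data p k /\ c = p ^+ k); last first.
  have zero L : canon L -> count (fun d => (d == c) || (d == cp c)) (ones L) = 0%N.
    move=> cL; apply/eqP; rewrite -leqn0 leqNgt -has_count; apply/hasPn => d din.
    have [p [k [dp ed]]] := ones_frob_data cL din; apply/negP => /orP[] /eqP e; apply: nc.
      by exists p, k; rewrite -e.
    exists (cp p), k; split; first exact: cp_frob_data.
    by rewrite -[c](cpK conj_invol) -e ed rmorphXn.
  by rewrite !zero.
(* If [cp c = c], then type (i) blocks are counted twice when eps <> 1 and do not occur when eps =
   1. Otherwise the two predicates are disjoint and their counts add. *)
have := cnt _ _ dp; rewrite -ec; have [cc|ncc] := eqVneq (cp c) c.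
  have orE L : count (fun d => (d == c) || (d == cp c)) (ones L) = count_mem c (ones L).
    by apply: eq_count => d; rewrite /= cc orbb.
  rewrite !orE.
  have [e1|ne] := classic (eps = 1); last first.
    by rewrite ec (twos_nil c1 dp (or_introl ne)) (twos_nil c2 dp (or_introl ne)) -ec cc !addn0 !addnn => /double_inj.
  have cpp : cp p = p.
    by move: cc; rewrite ec rmorphXn => /(frob_data_inj (cp_frob_data conj_invol dp) dp) [].
  by rewrite ec !ones_nil.
have cpp : cp p <> p by move=> e; rewrite ec rmorphXn /= e eqxx in ncc.
rewrite ec (twos_nil c1 dp (or_intror cpp)) (twos_nil c2 dp (or_intror cpp)) -ec !addn0 => e.
have orE L : count (fun d => (d == c) || (d == cp c)) (ones L) =
    (count_mem c (ones L) + count_mem (cp c) (ones L))%N.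
  rewrite -count_predUI -[LHS]addn0; congr (_ + _)%N; apply/esym/eqP.
  rewrite -leqn0 leqNgt -has_count; apply/hasPn => d _ /=.
  by apply: contra ncc => /andP[/eqP <- /eqP <-].
by rewrite !orE.
Qed.

(** Exchanging the roles of the two isotropic halves embeds the conjugate block, and the dimensions
    agree. *)
Lemma S1_conj_equiv p k : frob_data p k ->
  pair_equiv conj (sA conj (S1 p k)) (sF eps Phi1 (S1 p k))
                  (sA conj (S1 (cp p) k)) (sF eps Phi1 (S1 (cp p) k)).
Proof.
move=> dp; have cdp := cp_frob_data conj_invol dp.
have [w [v [cw cv nz ww vv]]] := S1_isotropic_pair conj Phi1 eps_sqr dp.
have hF := S1_herm Phi1 eps_sqr eps_conj p k; have sa := S1_selfadj conj_invol eps Phi1 p k.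
have [||X [eA eF]] := S1_embed conj_invol Phi1 hF eps_conj sa cdp _ _ nz ww vv.
- by rewrite -rmorphXn cpK.
- by rewrite -rmorphXn.
apply: embed_pair_equiv eA eF; first by rewrite /= /fsz -rmorphXn size_cp.
exact: S1_unit eps_sqr eps_conj _ _.
Qed.

Definition outside c (s : summand K) := if s is S2 q l _ then q ^+ l != c else true.

Lemma canon_filter a L : canon L -> canon (filter a L).
Proof. by elim: L => //= s L IH [cs /IH cL]; case: ifP. Qed.

Lemma ones_outside c L : ones (filter (outside c) L) = ones L.
Proof. by elim: L => [|[p k|p k f] L IH] //=; [rewrite IH | case: ifP]. Qed.

Lemma twos_outside c c' L :
  twos c' (filter (outside c) L) = if c' == c then [::] else twos c' L.
Proof.
elim: L => [|[p k|p k f] L IH] //=; first by case: ifP.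
have [->|nc] := eqVneq (p ^+ k) c => /=; rewrite IH; last first.
  by case: (eqVneq c' c) => // ->; rewrite (negPf nc).
by rewrite eq_sym; case: eqP.
Qed.

Lemma equiv_ds_group p k L : frob_data p k -> canon L ->
  equiv_ds L (map (S2 p k) (twos (p ^+ k) L) ++ filter (outside (p ^+ k)) L).
Proof.
move=> dp; elim: L => [|s L IH] /= => [_|[cs /IH {}IH]]; first exact: equiv_ds_refl.
have skip M : equiv_ds L (M ++ filter (outside (p ^+ k)) L) ->
    equiv_ds (s :: L) (M ++ s :: filter (outside (p ^+ k)) L).
  move=> e; apply: equiv_ds_trans (equiv_ds_sym (equiv_ds_rot _ _ _ _ _ _)).
  exact: equiv_ds_cons.
case: s cs skip => [q l|q l f] cs skip /=; first exact: skip.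
case: eqP => [e|_] /=; last exact: skip.
case: cs => dq _; have [eqp ekl] := frob_data_inj dq dp e; subst q l.
exact: equiv_ds_cons.
Qed.

Lemma mem_ones d L : d \in ones L -> exists La p k Lb, L = La ++ S1 p k :: Lb /\ d = p ^+ k.
Proof.
elim: L => [|[p k|p k f] L IH] //=.
  rewrite in_cons => /orP[/eqP ->|/IH [La [q [l [Lb [-> ->]]]]]]; first by exists [::], p, k, L.
  by exists (S1 p k :: La), q, l, Lb.
by case/IH => [La [q [l [Lb [-> ->]]]]]; exists (S2 p k f :: La), q, l, Lb.
Qed.

(** Induction on the number of summands. A type (i) summand of [L1] is cancelled against one of [L2]
    with the same or the conjugate polynomial; if there is none, the whole group of the first type
    (ii) summand is cancelled at once. *)
Lemma canon_rel_equiv L1 L2 : canon L1 -> canon L2 -> canon_rel conj L1 L2 -> equiv_ds L1 L2.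
Proof.
have [n] := ubnP (size L1); elim: n L1 L2 => // n IH L1 L2 sz c1 c2 [r1 r2].
have in12 d : d \in ones L1 -> exists2 d', d' \in ones L2 & (d' == d) || (d' == cp d).
  move=> din; apply/hasP; rewrite has_count -r1 -has_count; apply/hasP.
  by exists d; rewrite ?eqxx.
have in21 d : d \in ones L2 -> exists2 d', d' \in ones L1 & (d' == d) || (d' == cp d).
  move=> din; apply/hasP; rewrite has_count r1 -has_count; apply/hasP.
  by exists d; rewrite ?eqxx.
case e1: (ones L1) => [|d ds].
  have e2 : ones L2 = [::].
    by case e2: (ones L2) in21 => [//|d ds] /(_ d (mem_head _ _)) []; rewrite e1.
  case: L1 c1 e1 sz r1 r2 {in12 in21} => [|[p k|p k f] L] // c1 e1 sz r1 r2.
    case: L2 c2 e2 r1 r2 => [|[p k|p k f] L] // c2 _ _ r2; first exact: equiv_ds_refl.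
    have dp : frob_data p k by case: c2 => [[]].
    by have [] := r2 _ _ dp; rewrite /= eqxx.
  have [[dp [eps1 [exH _]]] _] := c1; have cpp := Phi1_exists_cp conj_invol dp exH.
  have phiH := Phi1_spec dp exH.
  apply: equiv_ds_trans (equiv_ds_group dp c1) _.
  apply: equiv_ds_trans (equiv_ds_sym (equiv_ds_group dp c2)).
  apply: equiv_ds_cat.
    have := blocks_equiv conj_invol two_neq0 dp cpp phiH (twos_good dp (canon_good c1))
      (twos_good dp (canon_good c2)) (r2 _ _ dp).
    by rewrite -{1}eps1.
  apply: IH; [| exact: canon_filter | exact: canon_filter |].
    by move: sz; rewrite /= eqxx /= ltnS; apply: leq_ltn_trans; rewrite size_filter count_size.
  split=> [c|q l dq]; first by rewrite !ones_outside.
  rewrite !twos_outside; case: eqP => _; last exact: r2.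
  by apply: herm_equiv_nil; case: dq => _ [].
have din : d \in ones L1 by rewrite e1 mem_head.
have [d' din' dd'] := in12 _ din.
have [La [p [k [Lb [eL1 ed]]]]] := mem_ones din.
have [La' [q [l [Lb' [eL2 ed']]]]] := mem_ones din'.
subst L1 L2; move: c1 c2 => /canon_cat [ca [[dp ns] cb]] /canon_cat [ca' [[dq ns'] cb']].
apply: equiv_ds_trans (equiv_ds_rot _ _ _ _ _ _) _.
apply: equiv_ds_trans (equiv_ds_sym (equiv_ds_rot _ _ _ _ _ _)).
rewrite -[S1 p k :: La ++ Lb]cat1s -[S1 q l :: La' ++ Lb']cat1s; apply: equiv_ds_cat.
  apply: pair_equiv_block (pair_equiv_refl _ _ _).
  case/orP: dd' => /eqP; rewrite ed ed'.
    by case/(frob_data_inj dq dp) => -> ->; apply: pair_equiv_refl.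
  rewrite rmorphXn => /(frob_data_inj dq (cp_frob_data conj_invol dp)) [-> ->].
  exact: S1_conj_equiv.
apply: IH; [|exact/canon_cat|exact/canon_cat|].
  by move: sz; rewrite !size_cat /= addnS ltnS.
split=> [c|r m dr]; last by have := r2 _ _ dr; rewrite !twos_cat.
have := r1 c; rewrite !ones_cat /= !count_cat /= -ed -ed'.
(* The predicate is invariant under conjugation of its argument, so both counts drop by the same
   amount. *)
have -> : (d' == c) || (d' == cp c) = (d == c) || (d == cp c).
  case/orP: dd' => /eqP -> //; rewrite -[c in cp d == c](cpK conj_invol).
  by rewrite !(inj_eq (can_inj (cpK conj_invol))) orbC.
lia.
Qed.

End Uniqueness.

(** * Existence of the canonical form *)

Section Existence.
Variables (K : fieldType) (conj : {rmorphism K -> K}).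
Hypothesis conj_invol : involutive conj.
Variables (eps : K) (Phi1 : forall c : {poly K}, 'M[K]_((size c).-1)).
Hypothesis eps_pm1 : eps = 1 \/ eps = -1.
Hypothesis eps_nonid : (exists a : K, conj a != a) -> eps = 1.
Hypothesis two_neq0 : (2%:R : K) != 0.
Hypothesis Phi1_spec : forall (p : {poly K}) (k : nat), frob_data p k ->
  Phi1_exists conj (p ^+ k) -> is_Phi1 conj (frob (p ^+ k)) (Phi1 (p ^+ k)).
Local Notation ct := (ct conj).
Local Notation cp := (conj_poly conj).
Local Notation pm := peval_mx.
Local Notation canon := (canon conj eps).
Local Notation good := (good conj eps Phi1).
Local Notation equiv_ds := (equiv_ds conj eps Phi1).
Implicit Types (f g h p q c d : {poly K}) (L : seq (summand K)).

(** Maximality of k makes the cofactor m prime to p; minimality of the polynomial keeps p^(k-1) m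
    from killing A. *)
Lemma mxminpoly_primary_factor n (A : 'M[K]_n) : (0 < n)%N ->
  exists p k m, [/\ frob_data p k, coprimep (p ^+ k) m, pm A (p ^+ k * m) = 0 &
    exists v : 'cV_n, pm A (p ^+ k.-1) *m (pm A m *m v) != 0].
Proof.
case: n A => // n A _; set mA := mxminpoly A.
have m0 : mA != 0 by apply/monic_neq0/mxminpoly_monic.
have [|p [mp ip] dp] := @irreducible_factor _ mA.
  by rewrite size_mxminpoly ltnS mxminpoly_nonconstant.
have bnd k : p ^+ k %| mA -> (k <= size mA)%N.
  move=> d; have := dvdp_leq m0 d; rewrite size_monic_exp //; apply: leq_trans.
  by rewrite ltnW // ltnS leq_pmull // -subn1 subn_gt0; case: ip.
have ex : exists k, p ^+ k %| mA by exists 0%N; rewrite expr0 dvd1p.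
case: (ex_maxnP ex bnd) => k /dvdpP [m em] kmax.
have k0 : (0 < k)%N by apply: kmax; rewrite expr1.
have npm : ~~ (p %| m).
  apply/negP => /dvdpP [m' em']; suff : (k < k)%N by rewrite ltnn.
  by apply: kmax; rewrite em em' exprS -mulrA dvdp_mull.
exists p, k, m; split=> //.
- by apply: coprimep_expl; apply: irreducible_coprime.
- by rewrite mulrC -em peval_mx_horner mx_root_minpoly.
apply: NNPP => no.
have : pm A (p ^+ k.-1 * m) = 0.
  apply/matrixP => i j; have : pm A (p ^+ k.-1) *m (pm A m *m delta_mx j 0) = 0 :> 'cV_n.+1.
    by apply/eqP/negPn/negP => nz; apply: no; exists (delta_mx j 0).
  by rewrite mulmxA -pmM -colE => /matrixP /(_ i 0); rewrite !mxE.
rewrite peval_mx_horner => /mxminpoly_min; rewrite -/mA em -{1}(prednK k0) exprS [m * _]mulrC -mulrA => d.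
have m'0 : p ^+ k.-1 * m != 0.
  by apply: contraNneq m0 => e; rewrite em -{1}(prednK k0) exprS mulrC -mulrA e mulr0.
have := dvdp_leq m'0 d; rewrite (size_mul (irredp_neq0 ip) m'0).
by case: ip => sp _; move: m'0; rewrite -size_poly_gt0; lia.
Qed.

Lemma dual_primary_pair n (A F : 'M[K]_n) : (0 < n)%N -> F \in unitmx -> selfadj conj A F ->
  exists p k (w v : 'cV_n), [/\ frob_data p k, pm A (cp (p ^+ k)) *m w = 0, pm A (p ^+ k) *m v = 0 &
    ct w *m F *m (pm A (p ^+ k.-1) *m v) != 0].
Proof.
move=> n0 uF sa; have [p [k [m [dp cpm ann [v0 nz]]]]] := mxminpoly_primary_factor A n0.
set v := pm A m *m v0 in nz; set x := pm A _ *m v in nz.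
have cv : pm A (p ^+ k) *m v = 0 by rewrite mulmxA -pmM ann mul0mx.
have [[a b] /= e] := Bezout_eq1_coprimepP _ _ cpm.
have k0 : (0 < k)%N by case: dp => _ [].
have cx : pm A (p ^+ k) *m x = 0 by rewrite /x mulmxA pm_comm -mulmxA cv mulmx0.
have bx : pm A (b * m) *m x = x.
  by rewrite -[RHS]mul1mx -(pm1 A) -e pmD mulmxDl (pmM _ a) -mulmxA cx mulmx0 add0r.
have [i nxi] : exists i, x i 0 != 0.
  apply: NNPP => no; case/eqP: nz; apply/matrixP => i j; rewrite ord1 [RHS]mxE.
  by apply/eqP/negPn/negP => nz'; apply: no; exists i.
have [w0 ew0] : exists w0 : 'cV_n, ct w0 *m F = delta_mx 0 i.
  by exists (ct (delta_mx 0 i *m invmx F)); rewrite ctK // mulmxKV.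
(* (b m)(A) is the identity on p^k-torsion. Its adjoint moves [w0] into the torsion of the conjugate
   of p^k without changing the pairing with x. *)
exists p, k, (pm A (cp (b * m)) *m w0), v; split=> //.
  rewrite mulmxA -pmM -rmorphM /= mulrCA [p ^+ k * m]mulrC [m * _]mulrC rmorphM pmM -mulmxA.
  suff -> : pm A (cp (p ^+ k * m)) = 0 by rewrite mul0mx mulmx0.
  by apply: (can_inj (mulKmx uF)); rewrite (selfadj_pm conj_invol _ sa) cpK // ann ct0 mul0mx mulmx0.
rewrite (selfadj_shift conj_invol) // cpK // bx ew0 -rowE.
by apply: contraNneq nxi => /matrixP /(_ 0 0); rewrite !mxE => ->.
Qed.

(** In f = f (a d + b [cp d]), the first term kills w directly and the second after moving to the
    other argument. *)
Lemma coprime_isotropic n (A F : 'M[K]_n) (w : 'cV_n) d f : selfadj conj A F ->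
  coprimep d (cp d) -> pm A d *m w = 0 -> ct w *m F *m (pm A f *m w) = 0.
Proof.
move=> sa /Bezout_eq1_coprimepP [[a b] /= e] dw.
rewrite -[f]mulr1 -e mulrDr pmD mulmxDl mulrA pmM -[_ *m pm A d *m w]mulmxA dw mulmx0 add0r.
rewrite mulrCA mulrA [_ * cp d]mulrC pmM -[_ *m w]mulmxA -(selfadj_shift conj_invol) // dw.
by rewrite ct0 !mul0mx.
Qed.

(** Here eps = -1 and the involution is trivial, so the value equals its own negative. *)
Lemma skew_isotropic n (A F : 'M[K]_n) (w : 'cV_n) f : eps <> 1 -> ct F = eps *: F ->
  selfadj conj A F -> ct w *m F *m (pm A f *m w) = 0.
Proof.
move=> ne hF sa; have e1 : eps = -1 by case: eps_pm1.
set x := _ *m _; have ctx : ct x = x.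
  by apply/matrixP => i j; rewrite !ord1 !mxE (conj_id eps_nonid).
have xN : x = - x.
  rewrite -{1}ctx /x !ctM ctK // hF e1 scaleN1r mulNmx mulmxN -ctM mulmxA.
  by rewrite (selfadj_shift conj_invol) // (cp_id eps_nonid).
apply/eqP; rewrite -[x == 0]orFb -(negPf two_neq0) -scaler_eq0 scaler_nat mulr2n {2}xN.
by rewrite subrr.
Qed.

Lemma existence n (A F : 'M[K]_n) : F \in unitmx -> ct F = eps *: F -> selfadj conj A F ->
  exists L, canon L /\ pair_equiv conj A F (dsA conj L) (dsF eps Phi1 L).
Proof.
have [m] := ubnP n; elim: m n A F => // m IH n A F; rewrite ltnS => le uF hF sa.
have [n0|n0] := posnP n.
  exists [::]; split=> //; move: A F {uF hF sa le}; rewrite n0 => A F.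
  by rewrite [A]flatmx0 [F]flatmx0; apply: pair_equiv_refl.
have [p [k [w [v [dp cw cv nz]]]]] := dual_primary_pair n0 uF sa.
have mc := frob_data_monic dp; have [mp [ip k0]] := dp.
(* Any nonzero nondegenerate invariant piece may be split off, the rest being canonical by
   induction. *)
have step (d : nat) (B G : 'M[K]_d) (X : 'M_(n, d)) : (0 < d)%N -> A *m X = X *m B ->
    ct X *m F *m X = G -> G \in unitmx ->
    exists L, canon L /\ pair_equiv conj A F (block_mx B 0 0 (dsA conj L)) (block_mx G 0 0 (dsF eps Phi1 L)).
  move=> d0 eA eG uG; have [r [A' [F' [uF' hF' sa' e]]]] := split_pair conj_invol uF hF sa eA eG uG.
  have [|L [cL eL]] := IH r A' F' _ uF' hF' sa'.
    by have := pair_equiv_dim e; lia.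
  exists L; split=> //; apply: pair_equiv_trans e _.
  by apply: pair_equiv_block eL; apply: pair_equiv_refl.
have d0 : (0 < fsz p k)%N by rewrite /fsz size_monic_exp //= muln_gt0 k0 (frob_data_deg dp).
have [[eps1 cpp]|ne] := classic (eps = 1 /\ cp p = p).
  rewrite eps1 scale1r in hF; rewrite rmorphXn /= cpp in cw.
  have [z cz nz'] := ex_anisotropic conj_invol two_neq0 hF sa cpp cw cv nz.
  have phiG := gram_is_Phi1 conj_invol hF sa dp cpp cz nz'.
  have exH : Phi1_exists conj (p ^+ k) by eexists; apply: phiG.
  have phiH := Phi1_spec dp exH.
  move eG0: (ct (krylov A z (fsz p k)) *m F *m krylov A z (fsz p k)) phiG => G phiG.
  have saG := is_Phi1_selfadj phiG; have saH := is_Phi1_selfadj phiH.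
  have [uH [hH _]] := phiH; have [uG [hG _]] := phiG.
  (* [Phi1] and G both intertwine Phi with its conjugate transpose, so their quotient lies in the
     commutant of Phi. *)
  have [f0 sf0 ef0] : exists2 f0 : {poly K}, (size f0 <= (size (p ^+ k)).-1)%N &
      invmx (Phi1 (p ^+ k)) *m G = pm (frob (p ^+ k)) f0.
    apply: frob_commutant; apply: (can_inj (mulKmx uH)).
    by rewrite -mulmxA mulKVmx // [RHS]mulmxA saH -mulmxA mulKVmx // saG.
  have eG : G = Phi1 (p ^+ k) *m pm (frob (p ^+ k)) f0 by rewrite -ef0 mulKVmx.
  (* Hermitian symmetry of G gives this modulo p^k; the degree bound makes it an equality. *)
  have cf0 : cp f0 = f0.
    apply/eqP; rewrite -subr_eq0; apply/eqP.
    rewrite -(modp_small (p := cp f0 - f0) (q := p ^+ k)); last first.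
      rewrite (leq_ltn_trans (size_polyD _ _)) // size_polyN size_cp maxnn.
      by rewrite -[X in (_ < X)%N]prednK ?ltnS // size_poly_gt0 monic_neq0.
    apply/eqP; rewrite -[_ == 0]/(p ^+ k %| _) -pm_frob_eq0 // pmB subr_eq0; apply/eqP.
    apply: (can_inj (mulKmx uH)); rewrite -eG -hG eG ctM hH.
    by rewrite (selfadj_pm conj_invol _ saH) cpK.
  (* Otherwise f0 p^(k-1) would vanish at Phi although f0(Phi) is invertible. *)
  have nf0 : ~~ (p %| f0).
    apply/negP => d; have : pm (frob (p ^+ k)) (f0 * p ^+ k.-1) = 0.
      by apply/eqP; rewrite pm_frob_eq0 // -{1}(prednK k0) exprS dvdp_mul2r ?expf_neq0 ?irredp_neq0.
    rewrite pmM -ef0 => e; have : pm (frob (p ^+ k)) (p ^+ k.-1) = 0.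
      apply: (can_inj (mulKmx uG)); apply: (can_inj (mulKmx (_ : invmx (Phi1 (p ^+ k)) \in unitmx))).
        by rewrite unitmx_inv.
      by rewrite mulmxA e !mulmx0.
    move/eqP; rewrite pm_frob_eq0 // gtNdvdp ?expf_neq0 ?irredp_neq0 //.
    by rewrite !size_monic_exp // ltnS ltn_pmul2l ?(frob_data_deg dp) // ltn_predL.
  have [L [cL eL]] := step _ _ _ _ d0 (krylov_frob mc cz) eG0 uG.
  (* The remainder meets the degree condition, and since f0 and f agree modulo p, the identity
     matrix is the required equivalence of forms. *)
  pose f := f0 %% p.
  have df : p %| f0 - f by rewrite /f {1}(divp_eq f0 p) addrK dvdp_mull.
  have nf : ~~ (p %| f).
    by apply: contra nf0 => d; rewrite -[f0](subrK f) dvdp_add.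
  have sf : (size f < size p)%N by rewrite ltn_modp irredp_neq0.
  have cf : cp f = f by rewrite /f /conj_poly map_modp -!/(cp _) cf0 cpp.
  exists (S2 p k f :: L); split.
    split=> //; do ?split=> //; apply: contraNneq nf => ->; exact: dvdp0.
  apply: pair_equiv_trans eL _.
  rewrite eG.
  apply: (@equiv_ds_cat _ _ eps Phi1 [:: S2 p k f0] [:: S2 p k f] L L); last exact: equiv_ds_refl.
  rewrite eps1; apply: (blocks_equiv conj_invol two_neq0 dp cpp phiH (fs := [:: f0]) (gs := [:: f])).
  - by move=> g; rewrite inE => /eqP ->.
  - by move=> g; rewrite inE => /eqP ->.
  split=> //; exists 1%:M; split=> [|i j].
    by rewrite det1 dvdp1 neq_ltn; case: ip => -> _; rewrite orbT.
  rewrite tr_scalar_mx map_scalar_mx /= rmorph1 mul1mx mulmx1 !ord1 mxE eqxx !mul1r.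
  exact: df.
(* Isotropy comes from skew symmetry when eps <> 1, and from coprimality of p^k and its conjugate
   when eps = 1. *)
have [f|f|X [eA eG]] := S1_embed conj_invol Phi1 hF (eps_conj conj eps_pm1) sa dp cw cv nz.
- have [e1|] := classic (eps = 1); last by move=> ?; apply: skew_isotropic.
  apply: coprime_isotropic cw => //; rewrite cpK // rmorphXn /=.
  apply: (frob_data_coprime (cp_frob_data conj_invol dp) dp).
  by apply/eqP => e; apply: ne.
- have [e1|] := classic (eps = 1); last by move=> ?; apply: skew_isotropic.
  apply: coprime_isotropic cv => //; rewrite rmorphXn /=.
  apply: (frob_data_coprime dp (cp_frob_data conj_invol dp)).
  by apply/eqP => e; apply: ne; rewrite -e.
have uS := S1_unit (conj := conj) Phi1 (eps_sqr eps_pm1) (eps_conj conj eps_pm1) p k.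
have [|L [cL eL]] := step _ _ _ _ _ eA eG uS; first by rewrite addn_gt0 d0.
(* Canonicity: for eps = 1, a [Phi1] would force [cp p = p], the case already treated. *)
exists (S1 p k :: L); split=> //; split=> //; split=> // e1 exH; apply: ne; split=> //.
exact: (Phi1_exists_cp conj_invol dp exH).
Qed.

End Existence.
Theorem theorem6 (K : fieldType) (conj : {rmorphism K -> K})
  (conj_invol : involutive conj)
  (eps : K) (eps_pm1 : eps = 1 \/ eps = -1)
  (eps_nonid : (exists a : K, conj a != a) -> eps = 1)
  (char_not2 : (2%:R : K) != 0)
  (Phi1 : forall c : {poly K}, 'M[K]_((size c).-1))
  (Phi1_spec : forall (p : {poly K}) (k : nat), frob_data p k ->
       Phi1_exists conj (p ^+ k) ->
       is_Phi1 conj (frob (p ^+ k)) (Phi1 (p ^+ k))) :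
  (* existence of the canonical form *)
  (forall (n : nat) (A F : 'M[K]_n),
     F \in unitmx -> ct conj F = eps *: F -> F *m A = ct conj A *m F ->
     exists L : seq (summand K),
       canon conj eps L /\
       pair_equiv conj A F (dsA conj L) (dsF eps Phi1 L))
  /\
  (* uniqueness: which canonical sums give the same pair *)
  (forall L1 L2 : seq (summand K),
     canon conj eps L1 -> canon conj eps L2 ->
     (pair_equiv conj (dsA conj L1) (dsF eps Phi1 L1)
                      (dsA conj L2) (dsF eps Phi1 L2)
      <-> canon_rel conj L1 L2)).
Proof.
split=> [n A F uF hF sa | L1 L2 c1 c2].
  exact: (existence conj_invol eps_pm1 eps_nonid char_not2 Phi1_spec uF hF sa).
split; first exact: (equiv_canon_rel conj_invol char_not2 Phi1_spec c1 c2).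
exact: (canon_rel_equiv conj_invol eps_pm1 char_not2 Phi1_spec c1 c2).
Qed.
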